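(* Let $K : M\times M\to\mathbb{R}$ be a covariance kernel on $M\subseteq\mathbb{R}^d$ with $\int_M K(t,t)\,\mu(\mathrm{d}t)<\infty$, let $\mathcal{K}$ be the associated integral operator on $L^2=L^2(M,\mathcal{B}^d_M,\mu)$, $\mathcal{K}f(s)=\int_M K(s,t)f(t)\,\mu(\mathrm{d}t)$, and let $\{\psi_j\}_{j\ge 1}$ be an orthonormal basis of $L^2$ (with $M$, $\mu$ and $K$ as specified in the context). Let $\{\lambda_i\}_{i\ge 1}$ denote the eigenvalues of $\mathcal{K}$, arranged in decreasing order and repeated according to their multiplicity. For each $n\in\mathbb{N}$, let $M_n=(K_{jk})_{1\le j,k\le n}$ be the $n\times n$ matrix with entries $K_{jk}=\langle \mathcal{K}\psi_j,\psi_k\rangle$, and let $\widehat{\lambda}_1\ge\cdots\ge\widehat{\lambda}_n$ (depending on $n$) be the solutions in $x$ of $\det(M_n-xI_n)=0$, where $I_n$ is the $n\times n$ identity matrix, arranged in decreasing order and repeated according to their multiplicity. Then, for each fixed $i\ge 1$, $$|\widehat{\lambda}_i-\lambda_i|\to 0\quad\text{as } n\to\infty.$$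
   Context: Setting. $\mathcal{B}^d$ is the Borel $\sigma$-algebra of $\mathbb{R}^d$, $M\in\mathcal{B}^d$ is nonempty, and $\mathcal{B}^d_M=\mathcal{B}^d\cap M$. The measure $\mu$ is a finite measure on $\mathcal{B}^d_M$. It is given either by $\mu(\mathrm{d}t)=w(t)\,\mathrm{d}t$ for a non-negative weight function $w$ on $M$ whose first moment is finite, $\int_M \|t\|\,w(t)\,\mathrm{d}t<\infty$, or, in the discrete case $M=\mathbb{N}_0=\{0,1,2,\ldots\}$, by a density with respect to counting measure. $L^2=L^2(M,\mathcal{B}^d_M,\mu)$ is the separable real Hilbert space of (equivalence classes of) measurable square-integrable functions on $M$, with inner product $\langle g,h\rangle=\int_M g h\,\mathrm{d}\mu$. It is taken to be infinite-dimensional, so that its orthonormal bases are indexed by $j\ge1$. Covariance kernel. $K(s,t)=\mathbb{E}[Z(s)Z(t)]$, $s,t\in M$, is the covariance kernel of a centered Gaussian process $Z=(Z(t),t\in M)$ that can be considered a random element of $L^2$ with $\mathbb{E}\|Z\|_{L^2}^2<\infty$. In particular $K$ is measurable, symmetric and nonnegative definite. The condition $\int_M K(t,t)\,\mu(\mathrm{d}t)<\infty$ implies $\int_M\int_M K(s,t)^2\,\mu(\mathrm{d}s)\,\mu(\mathrm{d}t)<\infty$. Eigenvalues. The eigenvalues of the kernel $K$ are those of the integral operator $\mathcal{K}:L^2\to L^2$, i.e. the values $\lambda$ for which $\lambda f=\mathcal{K}f$ has a nonzero solution $f\in L^2$. They are real and nonnegative, and the positive ones are at most countable, each of finite multiplicity.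 The sequence $\{\lambda_i\}_{i\ge1}$ lists the positive eigenvalues in decreasing (i.e. non-increasing) order with multiplicity; if there are only finitely many positive eigenvalues, the sequence is continued by zeros. For fixed $i$, $\widehat\lambda_i$ is defined for all $n\ge i$. *)

(* Defs.v *)
From HB Require Import structures.
From mathcomp Require Import all_boot all_order all_algebra.
From mathcomp Require Import all_classical all_reals all_analysis.
Set Implicit Arguments.
Unset Strict Implicit.
Unset Printing Implicit Defensive.
Import Order.TTheory GRing.Theory Num.Theory.
Import numFieldNormedType.Exports.
Local Open Scope classical_set_scope.
Local Open Scope ring_scope.

(* A measurableType is pointed, so the subspace carries a proof that M is
   nonempty; its sigma-algebra is the trace of the one of T on M. *)
Definition trace_type (T : Type) (M : set T) (_ : M !=set0) : Type := set_type M.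

Definition trace_val (T : Type) (M : set T) (M0 : M !=set0)
  (t : trace_type M0) : T := \val (t : set_type M).

Definition trace_display (d : measure_display) : measure_display.
Proof. exact. Qed.

Section trace_space.
Context d (T : measurableType d) (M : set T) (M0 : M !=set0).

HB.instance Definition _ := Choice.copy (trace_type M0) (set_type M).
HB.instance Definition _ := isPointed.Build (trace_type M0)
  (exist _ (projT1 (cid M0)) (mem_set (projT2 (cid M0)))).

Definition trace_measurable : set (set (trace_type M0)) :=
  preimage_set_system setT (@trace_val T M M0) measurable.

Let trace0 : trace_measurable set0.
Proof. by exists set0 => //; rewrite preimage_set0 setI0. Qed.

Let traceC A : trace_measurable A -> trace_measurable (~` A).
Proof.
by move=> [B mB <-]; exists (~` B); [exact: measurableC|
  rewrite !setTI preimage_setC].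
Qed.

Let trace_bigcup (F : (set (trace_type M0))^nat) :
  (forall i, trace_measurable (F i)) -> trace_measurable (\bigcup_i F i).
Proof.
move=> /(_ _)/cid2-/all_sig2[B mB BF].
exists (\bigcup_i B i); first exact: bigcup_measurable.
rewrite setTI preimage_bigcup; apply: eq_bigcupr => i _.
by rewrite -(BF i) setTI.
Qed.

HB.instance Definition _ := @isMeasurable.Build (trace_display d)
  (trace_type M0) trace_measurable trace0 traceC trace_bigcup.

End trace_space.

Lemma product_sigma_finite d1 d2 (T1 : measurableType d1)
    (T2 : measurableType d2) (R : realType)
    (m1 : {sigma_finite_measure set T1 -> \bar R})
    (m2 : {sigma_finite_measure set T2 -> \bar R}) :
  sigma_finite setT (m1 \x m2)%E.
Proof.
have /sigma_finiteP[F [TF ndF Foo]] := sigma_finiteT m1.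
have /sigma_finiteP[G [TG ndG Goo]] := sigma_finiteT m2.
exists (fun n => F n `*` G n).
  rewrite -setXTT TF TG predeqE => -[x y]; split.
    move=> [/= [n _ Fnx] [k _ Gky]]; exists (maxn n k) => //; split.
    - by move: x Fnx; exact/subsetPset/ndF/leq_maxl.
    - by move: y Gky; exact/subsetPset/ndG/leq_maxr.
  by move=> [n _ []/= ? ?]; split; exists n.
move=> k; have [? ?] := Foo k; have [? ?] := Goo k.
split; first exact: measurableX.
by rewrite product_measure1E// lte_mul_pinfty// ge0_fin_numE.
Qed.

Section lebesgue_tuple.
Context {R : realType}.
Local Notation RT := (measurableTypeR R).

Let ucons n (x : RT * n.-tuple RT) : n.+1.-tuple RT := [tuple of x.1 :: x.2].

Let mucons n : measurable_fun [set: RT * n.-tuple RT] (@ucons n).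
Proof. exact: measurable_cons. Qed.

Section step.
Variables (n : nat) (m : {sigma_finite_measure set (n.-tuple RT) -> \bar R}).

Definition lebesgue_cons : set (n.+1.-tuple RT) -> \bar R :=
  pushforward (@lebesgue_measure R \x m)%E (@ucons n).

Let lebesgue_cons0 : lebesgue_cons set0 = 0%E.
Proof. by rewrite /lebesgue_cons /pushforward preimage_set0 measure0. Qed.

Let lebesgue_cons_ge0 A : (0 <= lebesgue_cons A)%E.
Proof. exact: (measure_ge0 (@lebesgue_measure R \x m)%E). Qed.

Let lebesgue_cons_sigma_additive : semi_sigma_additive lebesgue_cons.
Proof.
have mpre A : measurable A -> measurable (@ucons n @^-1` A).
  by move=> mA; rewrite -[X in measurable X]setTI; exact: mucons.
move=> F mF tF mUF; rewrite /lebesgue_cons /pushforward preimage_bigcup.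
apply: measure_semi_sigma_additive => [k||].
- exact: mpre.
- apply/trivIsetP => i j _ _ ij; rewrite -preimage_setI.
  by move/trivIsetP : tF => /(_ _ _ _ _ ij) ->//; rewrite preimage_set0.
- by rewrite -preimage_bigcup; exact: mpre.
Qed.

HB.instance Definition _ := isMeasure.Build _ _ _ lebesgue_cons
  lebesgue_cons0 lebesgue_cons_ge0 lebesgue_cons_sigma_additive.

Let lebesgue_cons_sigma_finite : sigma_finite setT lebesgue_cons.
Proof.
have [F FT mF] := product_sigma_finite (@lebesgue_measure R) m.
pose uncons (t : n.+1.-tuple RT) : RT * n.-tuple RT :=
  (thead t, [tuple of behead t]).
have unconsK : cancel (@ucons n) uncons.
  by move=> [x t]; congr pair; apply/val_inj.
have consK : cancel uncons (@ucons n).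
  by move=> t; rewrite /ucons /= -tuple_eta.
have muncons : measurable_fun setT uncons.
  apply/measurable_fun_pairP; split.
    exact: measurable_tnth.
  exact: measurable_behead.
exists (fun k => uncons @^-1` F k).
  by rewrite -preimage_bigcup -FT preimage_setT.
move=> k; have [mFk Fk] := mF k; split.
  by rewrite -[X in measurable X]setTI; exact: muncons.
rewrite /lebesgue_cons /pushforward -comp_preimage.
by rewrite (_ : _ \o _ = id)//; apply/funext => x /=.
Qed.

HB.instance Definition _ :=
  Measure_isSigmaFinite.Build _ _ _ lebesgue_cons lebesgue_cons_sigma_finite.

End step.

(* Lebesgue measure on R^n, as the n-fold product of the one on R transported
   from iterated pairs to tuples. *)
Fixpoint lebesgue_tuple (n : nat) :
    {sigma_finite_measure set (n.-tuple RT) -> \bar R} :=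
  match n with
  | 0 => \d_([tuple] : 0.-tuple RT)
  | n'.+1 => lebesgue_cons (lebesgue_tuple n')
  end.

End lebesgue_tuple.

Notation Rspace R d := (d.-tuple (measurableTypeR R)).

Definition euclidean_norm (R : realType) (d : nat) (t : Rspace R d) : R :=
  Num.sqrt (\sum_(i < d) (tnth t i) ^+ 2).

Section reference_measure.
Context (R : realType) (d : nat) (M : set (Rspace R d)) (M0 : M !=set0).
Variable mu : {measure set (trace_type M0) -> \bar R}.

(* The preimages of Borel sets under the inclusion are all the measurable
   subsets of the subspace. *)
Definition weighted_lebesgue : Prop :=
  exists w : Rspace R d -> R,
    [/\ measurable_fun M w,
        forall t, M t -> 0 <= w t,
        forall A : set (Rspace R d), measurable A ->
          mu (@trace_val _ M M0 @^-1` A) =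
            (\int[lebesgue_tuple d]_(t in A `&` M) (w t)%:E)%E
      & (\int[lebesgue_tuple d]_(t in M) (euclidean_norm t * w t)%:E < +oo)%E].

Definition discrete_density : Prop :=
  [/\ d = 1%N,
      M = [set t | exists k : nat, forall i : 'I_d, tnth t i = k%:R]
    & exists2 p : trace_type M0 -> R,
        forall t, 0 <= p t
      & forall A : set (trace_type M0), measurable A ->
          mu A = (\int[@counting (trace_type M0) R]_(t in A) (p t)%:E)%E].

End reference_measure.

Section gaussian.
Context (R : realType) dO (Omega : measurableType dO) (P : probability Omega R).

(* In the library normal_prob 0 0 is not a point mass, hence the case s = 0. *)
Definition centered_gaussian_variable (X : Omega -> R) : Prop :=
  measurable_fun setT X /\
  exists s : R, forall A : set (measurableTypeR R), measurable A ->
    P (X @^-1` A) = if s == 0 then \d_(0 : R) A else normal_prob 0 s A.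

Definition centered_gaussian_process (I : Type) (Z : I -> Omega -> R) : Prop :=
  forall (n : nat) (t : 'I_n -> I) (c : 'I_n -> R),
    centered_gaussian_variable (fun w => \sum_(k < n) c k * Z (t k) w).

(* X is a Borel map into the separable space L^2, whose Borel sigma-algebra is
   generated by the open balls; it represents Z when almost every path of Z
   belongs to the class of X. *)
Definition is_L2_random_element d (T : measurableType d)
    (mu : {measure set T -> \bar R}) (Z : T -> Omega -> R)
    (X : Omega -> T -> R) : Prop :=
  [/\ forall w, X w \in Lfun mu 2%:E,
      forall (g : T -> R) (r : R), g \in Lfun mu 2%:E ->
        measurable
          [set w | ('N[mu]_2%:E[EFin \o (fun t => X w t - g t)%R] < r%:E)%E]
    & {ae P, forall w, {ae mu, forall t, X w t = Z t w}}].

(* K is the covariance kernel of a centered Gaussian process Z that can be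
   considered a random element of L^2 with finite second moment. Symmetry and
   nonnegative definiteness follow from the formula for K, joint measurability
   does not. *)
Definition gaussian_covariance_kernel d (T : measurableType d)
    (mu : {measure set T -> \bar R}) (Z : T -> Omega -> R)
    (K : T -> T -> R) : Prop :=
  [/\ centered_gaussian_process Z,
      exists2 X, is_L2_random_element mu Z X
        & (\int[P]_w ('N[mu]_2%:E[EFin \o X w] ^+ 2) < +oo)%E,
      forall s t, (K s t)%:E = ('E_P[(fun w => Z s w * Z t w)%R])%E
    & measurable_fun setT (fun p : T * T => K p.1 p.2)].

End gaussian.

Section integral_operator.
Context d (T : measurableType d) (R : realType).
Variable mu : {measure set T -> \bar R}.

Definition L2_inner (f g : T -> R) : R := \int[mu]_t (f t * g t).

Definition orthonormal_basis (psi : nat -> T -> R) : Prop :=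
  [/\ forall j, psi j \in Lfun mu 2%:E,
      forall j k, L2_inner (psi j) (psi k) = (j == k)%:R
    & forall f, f \in Lfun mu 2%:E ->
        ('N[mu]_2%:E[EFin \o (fun t : T =>
            f t - \sum_(j < n) L2_inner f (psi j) * psi j t)%R])%E
          @[n --> \oo] --> 0%E].

Variable K : T -> T -> R.

Definition kernel_operator (f : T -> R) (s : T) : R :=
  \int[mu]_t (K s t * f t).

Definition in_eigenspace (x : R) (f : T -> R) : Prop :=
  f \in Lfun mu 2%:E /\ {ae mu, forall s, x * f s = kernel_operator f s}.

(* The eigenspace of x, as a subspace of L^2 (functions modulo equality almost
   everywhere), has dimension m; for m = 0, x is not an eigenvalue. *)
Definition eigenspace_dim (x : R) (m : nat) : Prop :=
  exists v : 'I_m -> T -> R,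
    [/\ forall k, in_eigenspace x (v k),
        forall c : 'I_m -> R,
          {ae mu, forall s, \sum_(k < m) c k * v k s = 0} ->
          forall k, c k = 0
      & forall f, in_eigenspace x f ->
          exists c : 'I_m -> R,
            {ae mu, forall s, f s = \sum_(k < m) c k * v k s}].

(* Each positive number occurs in lam as often as its multiplicity; if there
   are only finitely many positive eigenvalues, the remaining terms are then
   nonnegative but not positive. *)
Definition eigenvalue_sequence (lam : nat -> R) : Prop :=
  [/\ nonincreasing_seq lam,
      forall i, 0 <= lam i
    & forall (x : R) (m : nat), 0 < x ->
        (eigenspace_dim x m <-> ([set i | lam i = x] #= `I_m)%card)].

Definition projected_matrix (psi : nat -> T -> R) (n : nat) : 'M[R]_n :=
  \matrix_(j < n, k < n) L2_inner (kernel_operator (psi j)) (psi k).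

End integral_operator.

Definition ordered_characteristic_roots (R : realType) (n : nat)
    (A : 'M[R]_n) (s : n.-tuple R) : Prop :=
  sorted >=%R s /\
  forall x : R, count_mem x s = mup x (\det (map_mx polyC A - 'X%:M)).

(* Main.v *)
Require Import Defs.
From mathcomp Require Import all_boot all_order all_algebra.
From mathcomp Require Import all_classical all_reals all_analysis.
From mathcomp Require Import ring lra measurable_realfun.

(** In coordinates with respect to the basis psi, the operator is the infinite
    symmetric matrix a_jk = <K psi_j, psi_k>, and the projected matrix of order
    n is its upper left corner. The Gaussian process enters through the symmetry
    of K and the Cauchy-Schwarz bound |K(s,t)| <= kap(s) kap(t), where
    kap(t) = sqrt K(t,t) is square integrable ([covariance_kernel_sym_le],
    [sqrt_diagonal_L2]). This bound makes the operator Hilbert-Schmidt in a strong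
    form: by Bessel's inequality for the functions K(s,.), the squared norms of
    the columns of a sum up to at most <kap,kap>^2
    ([kernel_column_norms_le]).

    The spectral theorem is used for finite matrices only: the projected
    matrix of order n has an orthonormal eigenbasis, listed in the order of
    its characteristic roots ([ordered_characteristic_roots_eigenbasis]). The
    eigenvalues and eigenvectors of the operator are then obtained as limits.
    Fix an ultrafilter U on the indices n that contains all cofinite sets.
    Every bounded sequence has a limit along U, so that the k-th root tends to
    some l_k and the k-th eigenvector tends coordinatewise to some vector v_k;
    the ultrafilter replaces a diagonal extraction of subsequences. The
    Hilbert-Schmidt bound has the following consequences.

    - The sequence l is nonincreasing and nonnegative and tends to 0
      ([limit_ge0], [limit_small]): for large n, only boundedly many roots can
      have absolute value above a given threshold.
    - Each v_k solves the eigenvalue equation for l_k, because the columns of a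
      are square summable ([limit_eigenvector]).
    - For x > 0, the vectors v_k with l_k = x are linearly independent
      ([limit_eigenvectors_free]): no mass escapes to infinity in the limit,
      since the images under a are dominated by a fixed summable sequence.
    - They span the eigenspace of x ([limit_eigenvectors_span]): an
      eigenfunction is almost an eigenvector of the projected matrices
      ([eigenfunction_residual]), hence almost a combination of those of their
      eigenvectors whose roots are close to x.

    A solution of the eigenvalue equation in coordinates is turned into an
    eigenfunction by [riesz_fischer]. Thus the eigenspace of every x > 0 has as
    dimension the number of k such that l_k = x. This is also the number of
    occurrences of x among the given eigenvalues, and two nonincreasing
    nonnegative sequences with the same finite multiplicities are equal
    ([noninc_eq_multiplicities]). So the limit of the i-th root is lam_i along
    every such ultrafilter U, which is convergence ([cvg_ultra]). *)

Set Implicit Arguments.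
Unset Strict Implicit.
Unset Printing Implicit Defensive.
Import Order.TTheory GRing.Theory Num.Theory.
Import numFieldNormedType.Exports.
Local Open Scope classical_set_scope.
Local Open Scope ring_scope.

(** * Finite sums and convergent series *)

Lemma cvg_bigsum {R : realType} (I : Type) (F : set_system I) {FF : Filter F}
    (J : Type) (r : seq J) (P : pred J) (f : J -> I -> R) (l : J -> R) :
  (forall j, P j -> f j @ F --> l j) ->
  (fun i => \sum_(j <- r | P j) f j i) @ F --> \sum_(j <- r | P j) l j.
Proof.
move=> fl; elim: r => [|j r IH].
  under eq_fun do rewrite big_nil.
  by rewrite big_nil; exact: cvg_cst.
under eq_fun do rewrite big_cons.
rewrite big_cons; case: ifPn => // Pj.
by apply: cvgD; [exact: fl | exact: IH].
Qed.

Lemma continuous_bigsum {R : realType} (T : topologicalType)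
    (J : Type) (r : seq J) (P : pred J) (f : J -> T -> R) :
  (forall j, P j -> continuous (f j)) ->
  continuous (fun x => \sum_(j <- r | P j) f j x).
Proof. by move=> cf x; apply: cvg_bigsum => j Pj; exact: cf. Qed.

Lemma cvg_sqr {R : realType} (I : Type) (F : set_system I) {FF : Filter F}
    (f : I -> R) (l : R) : f @ F --> l -> (fun i => f i ^+ 2) @ F --> l ^+ 2.
Proof.
by move=> fl; rewrite expr2; under eq_fun do rewrite expr2; exact: cvgM.
Qed.

Lemma sum_ord_split {R : nmodType} (F : nat -> R) m n : (m <= n)%N ->
  \sum_(i < n) F i = \sum_(i < m) F i + \sum_(m <= i < n) F i.
Proof.
by move=> mn; rewrite -!(big_mkord xpredT) (big_cat_nat (n := m)).
Qed.

(** The common source of the Cauchy-Schwarz inequalities for finite sums and for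
    integrals; the degenerate case r = 0 forces q = 0. *)
Lemma discriminant_le {R : realFieldType} (p q r : R) : 0 <= r ->
  (forall t, 0 <= p - 2 * t * q + t ^+ 2 * r) -> q ^+ 2 <= p * r.
Proof.
move=> r0 H; move: r0; rewrite le_eqVlt => /orP[/eqP r0|r0].
  have [->|q0] := eqVneq q 0; first by rewrite expr0n/= -r0 mulr0.
  (* this value of t makes the affine function equal to -1 *)
  have := H ((p + 1) / (2 * q)); rewrite -r0 mulr0 addr0.
  rewrite (_ : 2 * _ * q = p + 1); last by field.
  by rewrite opprD addrA subrr add0r oppr_ge0 ler10.
have := H (q / r).
rewrite (_ : _ + _ = p - q ^+ 2 / r); last by field; rewrite gt_eqF.
by rewrite subr_ge0 ler_pdivrMr.
Qed.

Lemma sum_cauchy_schwarz {R : realFieldType} (I : Type) (r : seq I) (P : pred I)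
    (f g : I -> R) :
  (\sum_(i <- r | P i) f i * g i) ^+ 2 <=
  (\sum_(i <- r | P i) f i ^+ 2) * (\sum_(i <- r | P i) g i ^+ 2).
Proof.
apply: discriminant_le; first by rewrite sumr_ge0// => i _; exact: sqr_ge0.
move=> t; rewrite !mulr_sumr -sumrN -!big_split/= sumr_ge0// => i _.
by rewrite (_ : _ + _ = (f i - t * g i) ^+ 2) ?sqr_ge0//; ring.
Qed.

(** Orthonormal columns preserve Euclidean norms. The entries are indexed by
    natural numbers because the order n varies later on. *)
Lemma sum_sqr_isometry {R : comRingType} n (q : nat -> nat -> R) (y : nat -> R) :
  (forall i j, (i < n)%N -> (j < n)%N -> \sum_(k < n) q k i * q k j = (i == j)%:R) ->
  \sum_(k < n) (\sum_(i < n) y i * q k i) ^+ 2 = \sum_(i < n) y i ^+ 2.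
Proof.
move=> qq.
under eq_bigr => k _.
  rewrite expr2 big_distrlr/=; over.
rewrite exchange_big/=; apply: eq_bigr => i _.
rewrite exchange_big/= (bigD1 i)//= [X in _ + X]big1 ?addr0.
  under eq_bigr => k _ do rewrite mulrACA.
  by rewrite -mulr_sumr qq// eqxx mulr1 expr2.
move=> j ji; under eq_bigr => k _ do rewrite mulrACA.
by rewrite -mulr_sumr qq// (_ : (_ == _) = false) ?mulr0//; apply/negbTE; rewrite eq_sym.
Qed.

Lemma nonneg_series_cvg {R : realType} (H : nat -> R) (D : R) :
  (forall j, 0 <= H j) -> (forall n, \sum_(j < n) H j <= D) ->
  exists2 l : R, (fun n => \sum_(j < n) H j) @ \oo --> l &
    forall n, \sum_(j < n) H j <= l.
Proof.
move=> H0 HD; pose S n := \sum_(j < n) H j.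
have Snd : nondecreasing_seq S.
  by move=> m n mn; rewrite /S (sum_ord_split _ mn) lerDl sumr_ge0// => j _.
have Sub : has_ubound (range S) by exists D => _ [n _ <-]; exact: HD.
have Scv := nondecreasing_is_cvgn Snd Sub.
by exists (limn S) => // n; exact: nondecreasing_cvgn_le.
Qed.

(** Summability in the form in which it is used along an ultrafilter: a null
    sequence that does not depend on the end n of the block. *)
Lemma bounded_series_tail {R : realType} (H : nat -> R) (D : R) :
  (forall j, 0 <= H j) -> (forall n, \sum_(j < n) H j <= D) ->
  exists tau : nat -> R, [/\ tau @ \oo --> (0 : R), forall m, 0 <= tau m &
    forall m n, (m <= n)%N -> \sum_(m <= j < n) H j <= tau m].
Proof.
move=> H0 HD; have [l Hl Hle] := nonneg_series_cvg H0 HD.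
exists (fun m => l - \sum_(j < m) H j); split.
- have /(_ _ _) := cvgB (cvg_cst l) Hl.
  by rewrite subrr; apply.
- by move=> m; rewrite subr_ge0.
- move=> m n mn; rewrite lerBrDl (le_trans _ (Hle n))//.
  by rewrite (sum_ord_split _ mn).
Qed.

(** By polarization, u w is a difference of squares of square summable
    sequences, so that monotone convergence is enough. *)
Lemma product_series_cvg {R : realType} (u w : nat -> R) (C D : R) :
  (forall n, \sum_(j < n) u j ^+ 2 <= C) ->
  (forall n, \sum_(j < n) w j ^+ 2 <= D) ->
  exists l : R, (fun n => \sum_(j < n) u j * w j) @ \oo --> l.
Proof.
move=> uC wD.
have bound (e : R) : e ^+ 2 = 1 ->
    forall n, \sum_(j < n) (u j + e * w j) ^+ 2 <= 2 * C + 2 * D.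
  move=> e2 n; apply: (@le_trans _ _ (\sum_(j < n) (2 * u j ^+ 2 + 2 * w j ^+ 2))).
    apply: ler_sum => j _; rewrite -subr_ge0.
    rewrite (_ : _ - _ = (u j - e * w j) ^+ 2 + 2 * (1 - e ^+ 2) * w j ^+ 2); last by ring.
    by rewrite e2 subrr mulr0 mul0r addr0 sqr_ge0.
  by rewrite big_split/= -!mulr_sumr lerD// ler_wpM2l ?uC ?wD.
have [||l1 l1P _] := @nonneg_series_cvg R (fun j => (u j + 1 * w j) ^+ 2) (2 * C + 2 * D).
- by move=> j; exact: sqr_ge0.
- by apply: bound; rewrite expr1n.
have [||l2 l2P _] := @nonneg_series_cvg R (fun j => (u j + -1 * w j) ^+ 2) (2 * C + 2 * D).
- by move=> j; exact: sqr_ge0.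
- by apply: bound; rewrite sqrrN expr1n.
exists (4^-1 * (l1 - l2)).
rewrite (_ : (fun _ => _) = fun n => 4^-1 * (\sum_(j < n) (u j + 1 * w j) ^+ 2 -
    \sum_(j < n) (u j + -1 * w j) ^+ 2)).
  by apply: cvgM; [exact: cvg_cst | exact: cvgB].
by apply/funext => n; rewrite -sumrB mulr_sumr; apply: eq_bigr => j _; field.
Qed.

(** * Diagonalization of real symmetric matrices *)

Section spectral.
Context {R : realType}.

Definition rayleigh n (B : 'M[R]_n) (v : 'rV[R]_n) : R := (v *m B *m v^T) 0 0.

Lemma rayleigh_continuous n (B : 'M[R]_n) : continuous (rayleigh B).
Proof.
rewrite (_ : rayleigh B =
    fun u => \sum_j (\sum_i u 0 i * B i j) * u 0 j); last first.
  by apply/funext => u; rewrite /rayleigh mxE; apply: eq_bigr => j _; rewrite !mxE.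
apply: continuous_bigsum => j _ v.
apply: continuousM; last exact: coord_continuous.
apply: continuous_bigsum => i _ {}v.
by apply: continuousM; [exact: coord_continuous | exact: cst_continuous].
Qed.

Lemma rayleighZ n (B : 'M[R]_n) (a : R) v :
  rayleigh B (a *: v) = a ^+ 2 * rayleigh B v.
Proof.
by rewrite /rayleigh linearZ/= -!scalemxAl -scalemxAr scalerA mxE expr2.
Qed.

Lemma rayleighD n (B : 'M[R]_n) u v : rayleigh B (u + v) =
  rayleigh B u + (u *m B *m v^T) 0 0 + ((v *m B *m u^T) 0 0 + rayleigh B v).
Proof.
rewrite /rayleigh linearD/= mulmxDl mulmxDl !mulmxDr [LHS]mxE.
by congr (_ + _); rewrite [LHS]mxE.
Qed.

Lemma row_sqrE n (v : 'rV[R]_n) : (v *m v^T) 0 0 = \sum_i v 0 i ^+ 2.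
Proof. by rewrite mxE; apply: eq_bigr => i _; rewrite mxE expr2. Qed.

Lemma row_sqr_ge0 n (v : 'rV[R]_n) : 0 <= (v *m v^T) 0 0.
Proof. by rewrite row_sqrE sumr_ge0// => i _; exact: sqr_ge0. Qed.

Lemma row_sqr_eq0 n (v : 'rV[R]_n) : (v *m v^T) 0 0 = 0 -> v = 0.
Proof.
move=> /eqP; rewrite row_sqrE psumr_eq0 => [/allP v0|i _]; last exact: sqr_ge0.
apply/rowP => i; rewrite mxE; apply/eqP.
by rewrite -(sqrf_eq0 (v 0 i)); apply: v0; rewrite mem_index_enum.
Qed.

Definition orthogonal_sphere k n (V : 'M[R]_(k, n)) : set 'rV[R]_n :=
  [set v | (v *m v^T) 0 0 = 1 /\ v *m V^T = 0].

(** Both constraints are level sets of quadratic forms, the orthogonality to V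
    being the vanishing of the form of V^T V. *)
Lemma orthogonal_sphere_compact k n (V : 'M[R]_(k, n)) :
  compact (orthogonal_sphere V).
Proof.
have E : orthogonal_sphere V =
    rayleigh 1%:M @^-1` [set 1] `&` rayleigh (V^T *m V) @^-1` [set 0].
  apply/seteqP; split => v /= [v1 v2]; split.
  - by rewrite /rayleigh mulmx1.
  - by rewrite /rayleigh mulmxA v2 !mul0mx mxE.
  - by move: v1; rewrite /rayleigh mulmx1.
  - apply: row_sqr_eq0; move: v2; rewrite /rayleigh.
    by rewrite trmx_mul trmxK !mulmxA.
apply: bounded_closed_compact.
  exists 1; split => // x x1 v [v1 _].
  apply: le_trans (ltW x1).
  rewrite [leLHS]/Num.norm /= mx_normrE; apply/bigmax_leP; split => //= -[i j] _ /=.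
  rewrite -(@ler_pXn2r _ 2) ?nnegrE//.
  rewrite expr1n real_normK ?num_real// -v1 row_sqrE.
  rewrite ord1 (bigD1 j)//= lerDl sumr_ge0// => ? _; exact: sqr_ge0.
have closed_level (B : 'M[R]_n) c : closed (rayleigh B @^-1` [set c]).
  apply: preimage_closed; last exact: closed_eq.
  by move=> ? _; exact: rayleigh_continuous.
by rewrite E; apply: closedI.
Qed.

Lemma orthogonal_sphere_nonempty k n (V : 'M[R]_(k, n)) :
  (k < n)%N -> orthogonal_sphere V !=set0.
Proof.
move=> kn.
have : kermx V^T != 0.
  rewrite -mxrank_eq0 mxrank_ker subn_eq0 -ltnNge.
  exact: leq_ltn_trans (rank_leq_col _) kn.
move=> /rowV0Pn[v /sub_kermxP vV v0].
have vv0 : 0 < (v *m v^T) 0 0.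
  rewrite lt_neqAle row_sqr_ge0 andbT eq_sym.
  by apply: contra v0 => /eqP/row_sqr_eq0 ->.
set c := (v *m v^T) 0 0 in vv0.
exists ((Num.sqrt c)^-1 *: v); split; last by rewrite -scalemxAl vV scaler0.
rewrite linearZ/= -scalemxAl -scalemxAr scalerA mxE -/c -expr2 exprVn.
by rewrite sqr_sqrtr ?ltW// mulVf// gt_eqF.
Qed.

(** Let u maximize the quadratic form of A on the unit vectors orthogonal to the
    eigenvectors already found, and let c be the maximum. On their orthogonal
    complement, c - A is then a positive semidefinite form that vanishes at u.
    The vector w = u (c - A) lies in this complement as well, and the form is
    nonnegative along the line u + t w only if w = 0. *)
Lemma rayleigh_max_eigenvector k n (A : 'M[R]_n) (V : 'M[R]_(k, n)) (d : 'rV[R]_k) :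
  (k < n)%N -> A^T = A -> V *m A = diag_mx d *m V ->
  exists (u : 'rV[R]_n) (c : R),
    [/\ (u *m u^T) 0 0 = 1, u *m V^T = 0 & u *m A = c *: u].
Proof.
move=> kn Asym VA.
have [u uS umax] := EVT_max_rV (orthogonal_sphere_nonempty V kn)
  (@orthogonal_sphere_compact _ _ V)
  (continuous_subspaceT (@rayleigh_continuous _ A)).
move: uS; rewrite inE => -[u1 uV].
set c := rayleigh A u in umax *.
exists u, c; split => //.
pose B := c%:M - A.
have Bsym : B^T = B by rewrite linearB/= tr_scalar_mx Asym.
have AV : A *m V^T = V^T *m diag_mx d.
  by rewrite -[A in LHS]Asym -trmx_mul VA trmx_mul tr_diag_mx.
have rB w : rayleigh B w = c * (w *m w^T) 0 0 - rayleigh A w.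
  by rewrite /rayleigh /B mulmxBr mulmxBl mul_mx_scalar -scalemxAl [LHS]mxE [X in X + _]mxE [X in _ + X]mxE.
have B_ge0 w : w *m V^T = 0 -> 0 <= rayleigh B w.
  move=> wV; have := row_sqr_ge0 w; rewrite le_eqVlt => /orP[/eqP/esym/row_sqr_eq0 ->|w0].
    by rewrite /rayleigh !mul0mx mxE.
  set e := (w *m w^T) 0 0 in w0.
  have : (Num.sqrt e)^-1 *: w \in orthogonal_sphere V.
    rewrite inE; split; last by rewrite -scalemxAl wV scaler0.
    rewrite linearZ/= -scalemxAl -scalemxAr scalerA mxE -/e -expr2 exprVn.
    by rewrite sqr_sqrtr ?ltW// mulVf// gt_eqF.
  move=> /umax; rewrite rayleighZ exprVn (sqr_sqrtr (ltW w0)) mulrC ler_pdivrMr//.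
  by rewrite rB -/e subr_ge0.
pose w := u *m B.
have wV : w *m V^T = 0.
  by rewrite /w /B mulmxBr mul_mx_scalar mulmxBl -scalemxAl uV scaler0 -mulmxA AV
    mulmxA uV mul0mx subr0.
have uB0 : rayleigh B u = 0 by rewrite rB u1 mulr1 subrr.
have key (t : R) : 0 <= 2 * t * (w *m w^T) 0 0 + t ^+ 2 * rayleigh B w.
  have := B_ge0 (u + t *: w).
  rewrite mulmxDl uV -scalemxAl wV scaler0 addr0 => /(_ erefl).
  have uBw : (w *m B *m u^T) 0 0 = (w *m w^T) 0 0.
    by rewrite /w trmx_mul Bsym mulmxA.
  rewrite rayleighD uB0 rayleighZ linearZ/= -!scalemxAl -scalemxAr.
  rewrite [X in _ + X + _]mxE [X in _ + (X + _)]mxE uBw -/w.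
  by congr (0 <= _); ring.
have w0 : (w *m w^T) 0 0 = 0.
  apply/eqP; rewrite eq_le row_sqr_ge0 andbT leNgt; apply/negP => w0.
  set e := (w *m w^T) 0 0 in key w0; set q := rayleigh B w in key.
  have q0 : 0 <= q by exact: B_ge0.
  (* t = -e / (1 + q) makes the quadratic negative *)
  have := key (- (e / (1 + q))).
  have q1 : 0 < 1 + q by rewrite ltr_pwDl.
  rewrite leNgt => /negP; apply.
  have -> : 2 * - (e / (1 + q)) * e + (- (e / (1 + q))) ^+ 2 * q
    = - (e / (1 + q)) ^+ 2 * (2 + q) by field; rewrite gt_eqF.
  rewrite mulNr oppr_lt0 mulr_gt0//; last by rewrite ltr_pwDl.
  by rewrite exprn_gt0// divr_gt0.
move: (row_sqr_eq0 w0); rewrite /w /B mulmxBr mul_mx_scalar => /eqP.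
by rewrite subr_eq0 => /eqP ->.
Qed.

Lemma orthonormal_eigenvectors n (A : 'M[R]_n) k : (k <= n)%N -> A^T = A ->
  exists (V : 'M[R]_(k, n)) (d : 'rV[R]_k),
    V *m V^T = 1%:M /\ V *m A = diag_mx d *m V.
Proof.
move=> + Asym; elim: k => [_|k IH kn].
  by exists 0, 0; split; apply/matrixP => -[].
have [V [d [VV VA]]] := IH (ltnW kn).
have [u [c [u1 uV uA]]] := rayleigh_max_eigenvector kn Asym VA.
have uu : u *m u^T = 1%:M.
  by apply/matrixP => i j; rewrite !ord1 u1 mxE.
have Vu : V *m u^T = 0 by rewrite -[V]trmxK -trmx_mul uV trmx0.
suff H : exists (V' : 'M[R]_(k + 1, n)) (d' : 'rV[R]_(k + 1)),
    V' *m V'^T = 1%:M /\ V' *m A = diag_mx d' *m V'.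
  by move: H; rewrite addn1.
exists (col_mx V u), (row_mx d c%:M); split.
  rewrite tr_col_mx mul_col_row VV Vu uV uu.
  by rewrite -scalar_mx_block.
rewrite mul_col_mx VA uA diag_mx_row mul_block_col !mul0mx addr0 add0r.
congr col_mx.
by apply/rowP => j; rewrite mul_diag_mx !mxE/= mulr1n.
Qed.

Lemma symmetric_diagonalization n (A : 'M[R]_n) : A^T = A ->
  exists (Q : 'M[R]_n) (d : 'rV[R]_n),
    [/\ Q *m Q^T = 1%:M, Q^T *m Q = 1%:M & Q *m A = diag_mx d *m Q].
Proof.
move=> /(orthonormal_eigenvectors (leqnn n))[Q [d [QQ QA]]].
by exists Q, d; split => //; exact: mulmx1C.
Qed.

End spectral.

(** The determinant is unchanged by conjugation with Q, hence equal to the product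
    of the d_k - X. *)
Lemma mup_char_det {R : realType} n (A Q : 'M[R]_n) (d : 'rV[R]_n) (x : R) :
  Q *m Q^T = 1%:M -> Q *m A = diag_mx d *m Q ->
  mup x (\det (map_mx polyC A - 'X%:M)) = count_mem x [seq d 0 k | k <- enum 'I_n].
Proof.
move=> QQ QA.
pose P := map_mx polyC Q.
have PP : P *m P^T = 1%:M by rewrite map_trmx -map_mxM QQ map_mx1.
have detE : \det (map_mx polyC A - 'X%:M) =
    (-1) ^+ n * \prod_(y <- [seq d 0 k | k <- enum 'I_n]) ('X - y%:P).
  have -> : \det (map_mx polyC A - 'X%:M) =
      \det (P *m (map_mx polyC A - 'X%:M) *m P^T).
    have : \det P * \det P^T = 1 by rewrite -det_mulmx PP det1.
    by rewrite !det_mulmx mulrAC => ->; rewrite mul1r.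
  rewrite mulmxBr mul_mx_scalar -map_mxM QA map_mxM mulmxBl -scalemxAl.
  rewrite -mulmxA -/P PP mulmx1 map_diag_mx.
  rewrite (_ : _ - _ = diag_mx (\row_k ((d 0 k)%:P - 'X))); last first.
    apply/matrixP => i j; rewrite !mxE; case: eqP => // _; rewrite ?mulr1n ?mulr1 //.
    by rewrite !mulr0n mulr0 subrr.
  rewrite det_diag big_map big_enum/=.
  rewrite (eq_bigr (fun k => - 1 * ('X - (d 0 k)%:P))); last first.
    by move=> k _; rewrite mxE mulN1r opprB.
  by rewrite big_split/= prodr_const card_ord.
rewrite detE mupMr ?mu_prod_XsubC//.
by rewrite -polyCN -polyC_exp rootC expf_neq0// oppr_eq0 oner_eq0.
Qed.

(** The roots are a permutation of the eigenvalues found by diagonalization, as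
    multiplicities agree; permuting the eigenvectors accordingly lists them in
    the order of s. *)
Lemma ordered_characteristic_roots_eigenbasis {R : realType} n (A : 'M[R]_n)
    (s : n.-tuple R) :
  A^T = A -> ordered_characteristic_roots A s ->
  exists Q : 'M[R]_n, [/\ Q *m Q^T = 1%:M, Q^T *m Q = 1%:M &
    Q *m A = diag_mx (\row_k tnth s k) *m Q].
Proof.
move=> /symmetric_diagonalization[Q [d [QQ _ QA]]] [_ sA].
have /perm.tuple_permP[p sp] : perm_eq s [tuple d 0 k | k < n].
  apply/allP => x _; rewrite /= sA (mup_char_det _ QQ QA).
  by rewrite /= -val_ord_tuple.
exists (row_perm p Q).
have QQ' : row_perm p Q *m (row_perm p Q)^T = 1%:M.
  rewrite row_permE trmx_mul -mulmxA [X in _ *m X]mulmxA QQ mul1mx.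
  by rewrite -row_permE; apply/matrixP => i j; rewrite !mxE (inj_eq perm.perm_inj) eq_sym.
split => //; first exact: mulmx1C.
rewrite row_permE -mulmxA QA -!row_permE; apply/matrixP => i j.
rewrite mul_diag_mx mxE mul_diag_mx !mxE.
by congr (_ * _); rewrite (tnth_nth 0) sp -tnth_nth !tnth_mktuple.
Qed.

(** * Limits along an ultrafilter *)

Section ultrafilter_limits.
Context {R : realType} (U : set_system nat) {UU : UltraFilter U}
  (Uoo : \oo `<=` U).

Lemma ultra_bounded_cvg (x : nat -> R) (C : R) : (forall n, `|x n| <= C) ->
  exists l : R, x @ U --> l.
Proof.
move=> xC.
have := @segment_compact R (- C) C; rewrite compact_ultra => /(_ (fmap x U)) [].
- split; first exact: fmap_proper_filter.
  move=> G GF xUG; apply/seteqP; split => // A GA; have [//|UA] := in_ultra_setVsetC (x @^-1` A) UU.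
  have /filter_ex[y []] : G (A `&` ~` A) by apply: filterI => //; exact: xUG.
  by [].
- suff : U (x @^-1` `[- C, C]) by [].
  by apply: filterS filterT => n _ /=; rewrite in_itv/= -ler_norml.
- by move=> l [_ xl]; exists l.
Qed.

Lemma ultra_ge m : U (fun n => (m <= n)%N).
Proof. by apply: Uoo; exact: nbhs_infty_ge. Qed.

Lemma ultra_limit_unique (x y : nat -> R) (l l' : R) :
  x @ U --> l -> y @ U --> l' -> U (fun n => x n = y n) -> l = l'.
Proof.
move=> xl yl xy; have yx : \forall n \near U, y n = x n by apply: filterS xy.
have yl' := cvg_trans (near_eq_cvg yx) yl.
exact: (cvg_unique (@Rhausdorff R) xl (yl' _)).
Qed.

(** Interchange of a limit along U with an infinite sum, when the tails of the sums
    are uniformly small. *)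
Lemma ultra_cvg_series (z : nat -> nat -> R) (zeta tau : nat -> R) (L : R) :
  (forall j, z ^~ j @ U --> zeta j) ->
  (fun n => \sum_(j < n) z n j) @ U --> L ->
  (forall m n, (m <= n)%N -> `|\sum_(m <= j < n) z n j| <= tau m) ->
  tau @ \oo --> 0 ->
  (fun m => \sum_(j < m) zeta j) @ \oo --> L.
Proof.
move=> zzeta zL ztau tau0.
suff H m : `|\sum_(j < m) zeta j - L| <= tau m.
  apply/cvgrPdist_lep => /=; near=> e; near=> m.
  rewrite distrC (le_trans (H m))// (le_trans (ler_norm _))//.
  near: m; move/cvgrPdist_le : tau0 => /(_ e) h.
  have /h : 0 < e by near: e; exact: nbhs_right_gt.
  by apply: filterS => m; rewrite sub0r normrN.
apply: (@cvgr_to_le _ U _ _ (fun n => `|\sum_(j < m) z n j - \sum_(j < n) z n j|)).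
  apply: cvg_norm; apply: cvgB => //.
  by apply: cvg_bigsum => j _; exact: zzeta.
apply: filterS (ultra_ge m) => n mn.
by rewrite (sum_ord_split _ mn) opprD addrA subrr sub0r normrN ztau.
Unshelve. all: by end_near.
Qed.

(** Dominated convergence for sums. It is derived from uniform tails because U is
    not countably generated, so that sequential arguments do not apply. *)
Lemma ultra_tannery (g : nat -> nat -> R) (H : nat -> R) (D : R) :
  (forall j, g ^~ j @ U --> (0 : R)) ->
  (forall n j, `|g n j| <= H j) -> (forall n, \sum_(j < n) H j <= D) ->
  (fun n => \sum_(j < n) g n j) @ U --> (0 : R).
Proof.
move=> g0 gH HD.
have H0 j : 0 <= H j by exact: le_trans (gH 0%N j).
have [L gL] : exists L : R, (fun n => \sum_(j < n) g n j) @ U --> L.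
  apply: (@ultra_bounded_cvg _ D) => n.
  by rewrite (le_trans (ler_norm_sum _ _ _))// (le_trans _ (HD n))// ler_sum.
have [tau [tau0 _ Htau]] := bounded_series_tail H0 HD.
have gtau m n : (m <= n)%N -> `|\sum_(m <= j < n) g n j| <= tau m.
  move=> mn; rewrite (le_trans (ler_norm_sum _ _ _))//.
  by rewrite (le_trans _ (Htau _ _ mn))// ler_sum.
have := ultra_cvg_series g0 gL gtau tau0.
rewrite (_ : (fun _ => _) = cst 0); last by apply/funext => m; rewrite big1.
by move=> /(cvg_unique (@Rhausdorff R) (cvg_cst _)) L0; rewrite -L0 in gL.
Qed.

(** Coordinatewise convergence of a bounded sequence in l^2 is weak convergence:
    the tails of the scalar products are controlled by those of al. *)
Lemma ultra_weak_cvg (y : nat -> nat -> R) (v al : nat -> R) (C D L : R) :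
  (forall i, y ^~ i @ U --> v i) ->
  (forall n, \sum_(i < n) y n i ^+ 2 <= C) ->
  (forall n, \sum_(i < n) al i ^+ 2 <= D) ->
  (fun n => \sum_(i < n) y n i * al i) @ U --> L ->
  (fun m => \sum_(i < m) v i * al i) @ \oo --> L.
Proof.
move=> yv yC alD yL.
have C0 : 0 <= C by have := yC 0%N; rewrite big_ord0.
have [tau [tau0 tau_ge0 Htau]] := bounded_series_tail (fun i => sqr_ge0 (al i)) alD.
apply: (@ultra_cvg_series (fun n i => y n i * al i) (fun i => v i * al i)
  (fun m => Num.sqrt (C * tau m)) L _ yL) => //.
- by move=> i; apply: cvgM => //; exact: cvg_cst.
- move=> m n mn; rewrite -sqrtr_sqr ler_sqrt ?mulr_ge0//.
  rewrite (le_trans (sum_cauchy_schwarz _ _ _ _))// ler_pM//.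
  + by rewrite sumr_ge0// => i _; exact: sqr_ge0.
  + by rewrite sumr_ge0// => i _; exact: sqr_ge0.
  + rewrite (le_trans _ (yC n))// (sum_ord_split (fun i => y n i ^+ 2) mn) lerDr sumr_ge0// => i _.
    exact: sqr_ge0.
  + exact: Htau.
- have -> : (0 : R) = Num.sqrt (C * 0) by rewrite mulr0 sqrtr0.
  apply: continuous_cvg; first exact: sqrt_continuous.
  by apply: cvgM => //; exact: cvg_cst.
Qed.

End ultrafilter_limits.

(** If a neighborhood of l were missed infinitely often, some ultrafilter would
    concentrate on the indices at which it is missed. *)
Lemma cvg_ultra {R : realType} (x : nat -> R) (l : R) :
  (forall U : set_system nat, UltraFilter U -> \oo `<=` U -> x @ U --> l) ->
  x @ \oo --> l.
Proof.
move=> H A lA; apply: contrapT => nA.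
have PF : ProperFilter (within (~` (x @^-1` A)) \oo).
  split; last exact: within_filter.
  by rewrite /within/= => h; apply: nA; apply: filterS h => n /contrapT.
have [U [UU sU]] := ultraFilterLemma PF.
have xU : x @ U --> l.
  apply: H => // B oB; apply: sU; apply: filterS oB => n Bn _; exact: Bn.
have UA : U (x @^-1` A) by exact: xU.
have UnA : U (~` (x @^-1` A)) by apply: sU; exact: withinT.
by have [n [An nAn]] := filter_ex (filterI UA UnA); exact: nAn An.
Qed.

(** * Eigensystems of growing truncations *)

(** The rows of q are an eigenbasis of the truncation of order n of a. Eigenvalues
    and vectors are extended by zero beyond n, so that systems of different
    orders can be compared coordinate by coordinate. *)
Definition eigensystem {R : realType} (a : nat -> nat -> R) (n : nat)
    (lam : nat -> R) (q : nat -> nat -> R) : Prop :=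
  [/\ forall k l, (k < n)%N -> (l < n)%N ->
        \sum_(j < n) q k j * q l j = (k == l)%:R,
      forall i j, (i < n)%N -> (j < n)%N ->
        \sum_(k < n) q k i * q k j = (i == j)%:R,
      forall k j, (k < n)%N -> (j < n)%N ->
        \sum_(i < n) q k i * a i j = lam k * q k j,
      forall k l, (k <= l)%N -> (l < n)%N -> lam l <= lam k
    & forall k, (n <= k)%N ->
        [/\ lam k = 0, forall j, q k j = 0 & forall j, q j k = 0]].

Section one_eigensystem.
Context {R : realType} (a : nat -> nat -> R) (n : nat) (lam : nat -> R)
  (q : nat -> nat -> R).
Hypothesis E : eigensystem a n lam q.

Lemma eigensystem_lam0 k : (n <= k)%N -> lam k = 0.
Proof. by case: E => _ _ _ _ E5 /E5[]. Qed.

Lemma eigensystem_combination_sqr (c : nat -> R) :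
  \sum_(j < n) (\sum_(k < n) c k * q k j) ^+ 2 = \sum_(k < n) c k ^+ 2.
Proof. by apply: (sum_sqr_isometry (q := fun j k => q k j)); case: E. Qed.

Lemma eigensystem_coordinates_sqr (y : nat -> R) :
  \sum_(k < n) (\sum_(i < n) y i * q k i) ^+ 2 = \sum_(i < n) y i ^+ 2.
Proof. by apply: sum_sqr_isometry; case: E. Qed.

Lemma eigensystem_row_sqr k m : \sum_(j < m) q k j ^+ 2 <= 1.
Proof.
case: E => E1 _ _ _ E5.
have [nk|kn] := leqP n k.
  by rewrite big1 ?ler01// => j _; have [_ -> _] := E5 k nk; rewrite expr0n.
have <- : \sum_(j < n) q k j ^+ 2 = 1.
  by under eq_bigr do rewrite expr2; rewrite E1// eqxx.
have [mn|/ltnW nm] := leqP m n.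
  rewrite (sum_ord_split (fun j => q k j ^+ 2) mn) lerDl sumr_ge0// => j _.
  exact: sqr_ge0.
rewrite (sum_ord_split (fun j => q k j ^+ 2) nm) gerDl.
rewrite big_nat big1// => j /andP[nj _].
by have [_ _ ->] := E5 j nj; rewrite expr0n.
Qed.

Lemma eigensystem_col_sqr j : \sum_(k < n) q k j ^+ 2 <= 1.
Proof.
case: E => _ E2 _ _ E5.
have [nj|jn] := leqP n j.
  by rewrite big1 ?ler01// => k _; have [_ _ ->] := E5 j nj; rewrite expr0n.
by under eq_bigr do rewrite expr2; rewrite E2// eqxx.
Qed.

Lemma eigensystem_entry k j : `|q k j| <= 1.
Proof.
rewrite -(@ler_pXn2r _ 2) ?nnegrE// expr1n real_normK ?num_real//.
apply: le_trans (eigensystem_row_sqr k j.+1).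
rewrite big_ord_recr/= lerDr sumr_ge0// => i _; exact: sqr_ge0.
Qed.

(** Both sides are the squared Hilbert-Schmidt norm of the truncation. *)
Lemma eigensystem_lam_sqr :
  \sum_(k < n) lam k ^+ 2 = \sum_(j < n) \sum_(i < n) a i j ^+ 2.
Proof.
case: (E) => E1 _ E3 _ _.
transitivity (\sum_(k < n) \sum_(j < n) (\sum_(i < n) a i j * q k i) ^+ 2).
  apply: eq_bigr => k _.
  transitivity (\sum_(j < n) (lam k * q k j) ^+ 2).
    under eq_bigr => j _ do rewrite exprMn expr2.
    by rewrite -mulr_sumr E1// eqxx mulr1.
  apply: eq_bigr => j _; rewrite -E3//; congr (_ ^+ 2).
  by apply: eq_bigr => i _; rewrite mulrC.
rewrite exchange_big/=; apply: eq_bigr => j _.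
exact: (eigensystem_coordinates_sqr (a^~ j)).
Qed.

End one_eigensystem.

Section limit_eigensystem.
Context {R : realType} (a : nat -> nat -> R) (h : nat -> R) (B : R)
  (lam : nat -> nat -> R) (q : nat -> nat -> nat -> R).
Hypotheses (asym : forall i j, a i j = a j i)
  (ah : forall j n, \sum_(i < n) a i j ^+ 2 <= h j)
  (hB : forall n, \sum_(j < n) h j <= B)
  (E : forall n, eigensystem a n (lam n) (q n)).

Lemma lam_sqr_le n : \sum_(k < n) lam n k ^+ 2 <= B.
Proof.
by rewrite (eigensystem_lam_sqr (E n)) (le_trans _ (hB n))// ler_sum.
Qed.

Lemma lam_sqr_prefix_le n m : \sum_(k < m) lam n k ^+ 2 <= B.
Proof.
have [mn|/ltnW nm] := leqP m n.
  rewrite (le_trans _ (lam_sqr_le n))//.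
  rewrite (sum_ord_split (fun k => lam n k ^+ 2) mn) lerDl sumr_ge0// => j _.
  exact: sqr_ge0.
rewrite (sum_ord_split (fun k => lam n k ^+ 2) nm).
rewrite big_nat [X in _ + X]big1 ?addr0 ?lam_sqr_le// => j /andP[nj _].
by rewrite (eigensystem_lam0 (E n))// expr0n.
Qed.

Lemma lam_norm_le n k : `|lam n k| <= Num.sqrt B.
Proof.
rewrite -sqrtr_sqr ler_wsqrtr// (le_trans _ (lam_sqr_prefix_le n k.+1))//.
by rewrite big_ord_recr/= lerDr sumr_ge0// => i _; exact: sqr_ge0.
Qed.

Variables (U : set_system nat) (UU : UltraFilter U) (Uoo : \oo `<=` U)
  (l : nat -> R) (v : nat -> nat -> R).
Hypotheses (laml : forall k, lam ^~ k @ U --> l k)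
  (qv : forall k j, (fun n => q n k j) @ U --> v k j).

Lemma limit_noninc k k' : (k <= k')%N -> l k' <= l k.
Proof.
move=> kk'; apply: (ler_cvg_to (@laml k') (@laml k)).
by apply: filterS (ultra_ge Uoo k'.+1) => n k'n; case: (E n) => _ _ _ + _; apply.
Qed.

(** If l k were negative, the roots from the k-th on would stay below a negative
    number for all n in a member of U; as their number n - k is unbounded there,
    the sum of their squares would exceed B. *)
Lemma limit_ge0 k : 0 <= l k.
Proof.
rewrite leNgt; apply/negP => lk0.
have e0 : 0 < (- l k) / 2 by rewrite divr_gt0// oppr_gt0.
set e := (- l k) / 2 in e0.
have lke : l k < - e by rewrite /e; lra.
have U1 : U (fun n => lam n k < - e) by exact: (@laml k _ (lt_nbhsl lke)).
have [p pB] : exists p : nat, B < p%:R * e ^+ 2.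
  exists (Num.bound (B / e ^+ 2)).
  by rewrite -ltr_pdivrMr ?exprn_gt0//; exact: unstable.ltr_bound.
have /filter_ex[n [/= lamn pn]] : U ((fun n => lam n k < - e) `&`
    (fun n => (k + p <= n)%N)) by apply: filterI => //; exact: ultra_ge.
have kn : (k <= n)%N by exact: leq_trans (leq_addr _ _) pn.
have := lam_sqr_le n; rewrite leNgt => /negP; apply.
rewrite (sum_ord_split (fun k => lam n k ^+ 2) kn).
rewrite ltr_wpDl ?sumr_ge0//; first by move=> *; exact: sqr_ge0.
apply: (lt_le_trans pB).
apply: (@le_trans _ _ (\sum_(k <= j < n) e ^+ 2)).
  rewrite sumr_const_nat -[leRHS]mulr_natl ler_wpM2r ?sqr_ge0// ler_nat.
  by rewrite leq_subRL.
apply: ler_sum_nat => j /andP[kj jn].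
have lamj : lam n j <= - e.
  by rewrite (le_trans _ (ltW lamn))//; case: (E n) => _ _ _ + _; apply.
have elamj : e <= - lam n j by rewrite lerNr.
by rewrite -[leRHS]sqrrN ler_pXn2r ?nnegrE ?(ltW e0)// (le_trans (ltW e0)).
Qed.

Lemma limit_sqr_le m : \sum_(k < m) l k ^+ 2 <= B.
Proof.
apply: (@cvgr_to_le _ U _ _ (fun n => \sum_(k < m) lam n k ^+ 2)).
  by apply: cvg_bigsum => k _; exact: cvg_sqr.
by apply: filterS filterT => n _; exact: lam_sqr_prefix_le.
Qed.

(** The k first terms are at least l k, and the sum of their squares is at most B. *)
Lemma limit_small x : 0 < x -> exists N, forall k, (N <= k)%N -> l k < x.
Proof.
move=> x0.
exists (Num.bound (B / x ^+ 2)) => k Nk; rewrite ltNge; apply/negP => xlk.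
have := limit_sqr_le k; rewrite leNgt => /negP; apply.
have H : B < k%:R * x ^+ 2.
  rewrite -ltr_pdivrMr ?exprn_gt0//.
  by apply: lt_le_trans (unstable.ltr_bound _) _; rewrite ler_nat.
apply: (lt_le_trans H); rewrite mulr_natl -[X in _ *+ X](card_ord k) -sumr_const.
apply: ler_sum => j _; rewrite ler_pXn2r ?nnegrE ?limit_ge0 ?(ltW x0)//.
by apply: le_trans xlk _; apply: limit_noninc; exact: ltnW.
Qed.

Lemma limit_vector_sqr_le k m : \sum_(j < m) v k j ^+ 2 <= 1.
Proof.
apply: (@cvgr_to_le _ U _ _ (fun n => \sum_(j < m) q n k j ^+ 2)).
  by apply: cvg_bigsum => j _; exact: cvg_sqr.
by apply: filterS filterT => n _; exact: (eigensystem_row_sqr (E n)).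
Qed.

Lemma limit_eigenvector k j :
  (fun m => \sum_(i < m) v k i * a i j) @ \oo --> l k * v k j.
Proof.
apply: (@ultra_weak_cvg _ U UU Uoo (fun n i => q n k i) _ (a^~ j) 1 (h j)).
- by move=> i; exact: qv.
- by move=> n; exact: (eigensystem_row_sqr (E n)).
- exact: ah.
have H : (fun n => lam n k * q n k j) @ U --> l k * v k j by apply: cvgM.
apply: cvg_trans H; apply: near_eq_cvg.
have := ultra_ge Uoo (maxn k.+1 j.+1); apply: filterS => n.
by rewrite geq_max => /andP[kn jn]; case: (E n) => _ _ + _ _ => ->.
Qed.

(** Let y n be the combination of eigenvectors of order n with the coefficients c.
    It tends to 0 coordinatewise along U. The squared norm of its image under the
    truncation tends to x^2 times the sum of the squares of c, as the
    eigenvectors are orthonormal. It also tends to 0 by dominated convergence,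
    because the j-th coordinate of the image has a square of at most a constant
    times h j. *)
Lemma limit_eigenvectors_free x N (c : nat -> R) : x != 0 ->
  (forall j, \sum_(k < N | l k == x) c k * v k j = 0) ->
  forall k, (k < N)%N -> l k = x -> c k = 0.
Proof.
move=> x0 cv0.
pose C := \sum_(k < N | l k == x) c k ^+ 2.
suff C0 : C = 0.
  move=> k kN lkx; move/eqP: C0; rewrite /C psumr_eq0; last by move=> ? _; exact: sqr_ge0.
  move=> /allP/(_ (Ordinal kN) (mem_index_enum _))/=.
  by rewrite lkx eqxx sqrf_eq0 => /eqP.
have C_ge0 : 0 <= C by rewrite sumr_ge0// => k _; exact: sqr_ge0.
pose y n i := \sum_(k < N | l k == x) c k * q n k i.
pose c' k := if (k < N)%N && (l k == x) then c k else 0.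
have split_sum n (f : nat -> R) : (N <= n)%N ->
    \sum_(k < N | l k == x) c k * f k = \sum_(k < n) c' k * f k.
  move=> Nn; rewrite (sum_ord_split (fun k => c' k * f k) Nn).
  rewrite big_nat [X in _ = _ + X]big1 ?addr0; last first.
    by move=> k /andP[Nk _]; rewrite /c' ltnNge Nk/= mul0r.
  rewrite big_mkcond/=; apply: eq_bigr => k _; rewrite /c' ltn_ord/=.
  by case: ifP; rewrite ?mul0r.
have split_sqr n : (N <= n)%N -> C = \sum_(k < n) c' k ^+ 2.
  move=> Nn; rewrite -[RHS]/(\sum_(k < n) c' k ^+ 2) /C.
  under eq_bigr do rewrite expr2.
  rewrite (split_sum n)//; apply: eq_bigr => k _.
  by rewrite /c'; case: ifP; rewrite ?mul0r ?expr0n ?expr2.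
have ysqr n : (N <= n)%N -> \sum_(i < n) y n i ^+ 2 = C.
  move=> Nn; rewrite (split_sqr n Nn) -(eigensystem_combination_sqr (E n) c').
  by apply: eq_bigr => i _; rewrite /y (split_sum n (fun k => q n k i)).
(* For n < N the combination also runs over zero rows of q n and its norm is
   not controlled by C; cutting it off there makes the bounds uniform in n. *)
pose y' n i := if (N <= n)%N then y n i else 0.
have y'sqr n : \sum_(i < n) y' n i ^+ 2 <= C.
  rewrite /y'; have [Nn|nN] := leqP N n; first by rewrite ysqr.
  by rewrite big1 => // i _; rewrite expr0n.
have y'0 i : y' ^~ i @ U --> (0 : R).
  have : y ^~ i @ U --> (0 : R).
    rewrite -(cv0 i); apply: cvg_bigsum => k _.
    by apply: cvgM; [exact: cvg_cst | exact: qv].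
  apply: cvg_trans; apply: near_eq_cvg.
  by apply: filterS (ultra_ge Uoo N) => n Nn; rewrite /y' Nn.
pose g' n j := \sum_(i < n) y' n i * a i j.
have g'le n j : g' n j ^+ 2 <= C * h j.
  rewrite (le_trans (sum_cauchy_schwarz _ _ _ _))// ler_pM//.
  - by rewrite sumr_ge0// => *; exact: sqr_ge0.
  - by rewrite sumr_ge0// => *; exact: sqr_ge0.
have g'0 j : g' ^~ j @ U --> (0 : R).
  have [L gL] : exists L : R, g' ^~ j @ U --> L.
    apply: (@ultra_bounded_cvg _ _ UU _ (Num.sqrt (C * h j))) => n.
    by rewrite -sqrtr_sqr ler_wsqrtr.
  have := @ultra_weak_cvg _ _ UU Uoo y' _ (a^~ j) _ _ _ y'0 y'sqr (ah j) gL.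
  rewrite (_ : (fun _ => _) = cst 0); last first.
    by apply/funext => m; rewrite big1// => i _; rewrite mul0r.
  by move=> L0; have L00 := cvg_unique (@Rhausdorff R) L0 (cvg_cst _); rewrite L00 in gL.
have lim0 : (fun n => \sum_(j < n) g' n j ^+ 2) @ U --> (0 : R).
  apply: (@ultra_tannery _ _ UU Uoo (fun n j => g' n j ^+ 2) (fun j => C * h j) (C * B)).
  - by move=> j; rewrite -[X in _ --> X](expr0n R 2); exact: cvg_sqr.
  - by move=> n j; rewrite ger0_norm ?sqr_ge0.
  - by move=> n; rewrite -mulr_sumr ler_wpM2l.
have limC : (fun n => \sum_(k < N | l k == x) (c k * lam n k) ^+ 2) @ U --> x ^+ 2 * C.
  rewrite /C mulr_sumr.
  apply: cvg_bigsum => k /eqP lkx; rewrite -lkx -exprMn mulrC; apply: cvg_sqr.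
  by apply: cvgM; [exact: cvg_cst | exact: laml].
have : x ^+ 2 * C = 0.
  apply: (ultra_limit_unique limC lim0).
  apply: filterS (ultra_ge Uoo N) => n Nn.
  under [RHS]eq_bigr => j _.
    rewrite (_ : g' n j = \sum_(k < n) (c' k * lam n k) * q n k j); last first.
      rewrite /g'; under eq_bigr => i _.
        rewrite /y' Nn /y (split_sum n (fun k => q n k i))// mulr_suml; over.
      rewrite exchange_big/=; apply: eq_bigr => k _.
      under eq_bigr => i _ do rewrite -mulrA.
      by rewrite -mulr_sumr -mulrA; congr (_ * _); case: (E n) => _ _ -> .
    over.
  rewrite (eigensystem_combination_sqr (E n) (fun k => c' k * lam n k)).
  under eq_bigr => k _ do rewrite exprMn expr2 -mulrA.
  rewrite (split_sum n (fun k => c k * lam n k ^+ 2))//.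
  apply: eq_bigr => k _; rewrite /c'; case: ifP => _; first by rewrite exprMn expr2 mulrA.
  by rewrite !mul0r expr0n.
by move=> /eqP; rewrite mulf_eq0 expf_eq0/= (negbTE x0)/= => /eqP.
Qed.

(** Let c n k be the coordinates of b in the eigenbasis of order n. The hypothesis
    says that the sum over k of (lam n k - x)^2 (c n k)^2 tends to 0. So c n k
    tends to 0 whenever l k differs from x, and the part of b that belongs to the
    indices k >= N is negligible, as the difference of lam n k and x is then
    at least x / 2. The remaining indices are finite in number and give the
    expansion in the limit. *)
Lemma limit_eigenvectors_span x N (b : nat -> R) C : 0 < x ->
  (forall k, (N <= k)%N -> l k < x / 2) ->
  (forall n, \sum_(i < n) b i ^+ 2 <= C) ->
  (fun n => \sum_(j < n) (\sum_(i < n) b i * a i j - x * b j) ^+ 2) @ \oo --> (0 : R) ->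
  exists c : nat -> R, forall j, b j = \sum_(k < N | l k == x) c k * v k j.
Proof.
move=> x0 lN bC bx0.
pose delta n := \sum_(j < n) (\sum_(i < n) b i * a i j - x * b j) ^+ 2.
have delta0 : delta @ U --> (0 : R) by move=> A /bx0; exact: Uoo.
pose c n k := \sum_(i < n) b i * q n k i.
have cC n k : `|c n k| <= Num.sqrt C.
  rewrite -sqrtr_sqr ler_wsqrtr// (le_trans (sum_cauchy_schwarz _ _ _ _))//.
  rewrite -[leRHS]mulr1 ler_pM ?sumr_ge0//; [by move=> *; exact: sqr_ge0| |].
    by move=> *; exact: sqr_ge0.
  exact: (eigensystem_row_sqr (E n)).
have /choice[c' cc'] : forall k, exists ck : R, c ^~ k @ U --> ck.
  by move=> k; exact: ultra_bounded_cvg (cC ^~ k).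
have deltaE n : delta n = \sum_(k < n) ((lam n k - x) * c n k) ^+ 2.
  rewrite /delta -(eigensystem_coordinates_sqr (E n)
    (fun j => \sum_(i < n) b i * a i j - x * b j)).
  apply: eq_bigr => k _; congr (_ ^+ 2).
  under eq_bigr => j _ do rewrite mulrBl -mulrA mulr_suml.
  rewrite sumrB -mulr_sumr -/(c n k) mulrBl; congr (_ - _).
  rewrite exchange_big/= /c mulr_sumr; apply: eq_bigr => i _.
  under eq_bigr => j _ do rewrite -mulrA [a _ _ * _]mulrC asym.
  rewrite -mulr_sumr; case: (E n) => _ _ -> // _ _.
  by rewrite mulrCA.
have c'0 k : l k != x -> c' k = 0.
  move=> lkx.
  have H : (fun n => ((lam n k - x) * c n k) ^+ 2) @ U --> ((l k - x) * c' k) ^+ 2.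
    by apply: cvg_sqr; apply: cvgM => //; apply: cvgB => //; exact: cvg_cst.
  have : ((l k - x) * c' k) ^+ 2 <= 0.
    apply: (ler_cvg_to H delta0); apply: filterS (ultra_ge Uoo k.+1) => n kn.
    by rewrite deltaE (bigD1 (Ordinal kn))//= lerDl sumr_ge0// => *; exact: sqr_ge0.
  rewrite le_eqVlt ltNge sqr_ge0 orbF sqrf_eq0 mulf_eq0 subr_eq0 (negbTE lkx)/=.
  by move=> /eqP.
exists c' => j.
have -> : \sum_(k < N | l k == x) c' k * v k j = \sum_(k < N) c' k * v k j.
  rewrite big_mkcond/=; apply: eq_bigr => k _; case: ifPn => // /c'0 ->.
  by rewrite mul0r.
have lim1 : (fun n => \sum_(k < N) c n k * q n k j) @ U --> \sum_(k < N) c' k * v k j.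
  by apply: cvg_bigsum => k _; apply: cvgM => //; exact: qv.
have H0 : (fun n => Num.sqrt (4 / x ^+ 2 * delta n)) @ U --> (0 : R).
  have -> : (0 : R) = Num.sqrt (4 / x ^+ 2 * 0) by rewrite mulr0 sqrtr0.
  apply: continuous_cvg; first exact: sqrt_continuous.
  by apply: cvgM => //; exact: cvg_cst.
apply/eqP; rewrite -subr_eq0 -normr_le0.
have lim2 : (fun n => `|b j - \sum_(k < N) c n k * q n k j|) @ U -->
    `|b j - \sum_(k < N) c' k * v k j|.
  by apply: cvg_norm; apply: cvgB => //; exact: cvg_cst.
apply: (ler_cvg_to lim2 H0).
have UN : U (fun n => lam n N < x / 2).
  exact: (@laml N _ (lt_nbhsl (lN _ (leqnn N)))).
have Un := ultra_ge Uoo (maxn N.+1 j.+1).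
apply: filterS (filterI UN Un) => n [/= lamN].
rewrite geq_max => /andP[/ltnW Nn jn].
have -> : b j = \sum_(k < n) c n k * q n k j.
  under eq_bigr => k _ do rewrite /c mulr_suml.
  rewrite exchange_big/=.
  under eq_bigr => i _.
    under eq_bigr => k _ do rewrite -mulrA.
    rewrite -mulr_sumr; case: (E n) => _ -> // _ _ _; over.
  rewrite (bigD1 (Ordinal jn))//= eqxx mulr1 big1 ?addr0// => i ij.
  by rewrite (_ : (_ == _) = false) ?mulr0//; apply/negbTE.
rewrite (sum_ord_split (fun k => c n k * q n k j) Nn) addrAC subrr add0r.
rewrite -sqrtr_sqr ler_wsqrtr// (le_trans (sum_cauchy_schwarz _ _ _ _))//.
rewrite -[leRHS]mulr1 ler_pM ?sumr_ge0//; [by move=> *; exact: sqr_ge0| | |].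
- by move=> *; exact: sqr_ge0.
- rewrite deltaE (sum_ord_split (fun k => ((lam n k - x) * c n k) ^+ 2) Nn).
  rewrite mulrDr ler_wpDl//.
    by rewrite mulr_ge0 ?divr_ge0 ?sqr_ge0// sumr_ge0// => *; exact: sqr_ge0.
  rewrite mulr_sumr; apply: ler_sum_nat => k /andP[Nk kn].
  have lamk : lam n k < x / 2.
    by apply: le_lt_trans lamN; case: (E n) => _ _ _ + _; apply.
  rewrite exprMn mulrA ler_peMl ?sqr_ge0//.
  rewrite mulrAC ler_pdivlMr ?exprn_gt0// mul1r.
  have : (x / 2) ^+ 2 <= (x - lam n k) ^+ 2.
    by rewrite ler_pXn2r ?nnegrE//; lra.
  rewrite exprMn; lra.
- rewrite (le_trans _ (eigensystem_col_sqr (E n) j))//.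
  rewrite (sum_ord_split (fun k => q n k j ^+ 2) Nn) lerDr sumr_ge0// => *.
  exact: sqr_ge0.
Qed.

End limit_eigensystem.

Lemma eigensystem_of_matrix {R : realType} (a : nat -> nat -> R) n
    (s : n.-tuple R) (A : 'M[R]_n) :
  (forall i j, a i j = a j i) -> (forall i j : 'I_n, A i j = a i j) ->
  ordered_characteristic_roots A s ->
  exists q, eigensystem a n (nth 0 s) q.
Proof.
move=> asym Aa As.
have Asym : A^T = A by apply/matrixP => i j; rewrite mxE !Aa asym.
have [Q [QQ QQ' QA]] := ordered_characteristic_roots_eigenbasis Asym As.
pose q k j := if insub k is Some k' then
  if insub j is Some j' then Q k' j' else 0 else 0.
have qE (k j : 'I_n) : q k j = Q k j by rewrite /q !valK.
exists q; split.
- move=> k l kn ln; have := congr1 (fun X : 'M[R]_n => X (Ordinal kn) (Ordinal ln)) QQ.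
  rewrite !mxE => <-; apply: eq_bigr => j _.
  by rewrite mxE -(qE (Ordinal kn)) -(qE (Ordinal ln)).
- move=> i j ni nj; have := congr1 (fun X : 'M[R]_n => X (Ordinal ni) (Ordinal nj)) QQ'.
  rewrite !mxE => <-; apply: eq_bigr => k _.
  by rewrite mxE -(qE _ (Ordinal ni)) -(qE _ (Ordinal nj)).
- move=> k j kn jn; have := congr1 (fun X : 'M[R]_n => X (Ordinal kn) (Ordinal jn)) QA.
  rewrite mul_diag_mx mxE [RHS]mxE mxE (tnth_nth 0) -(qE (Ordinal kn) (Ordinal jn)) => <-.
  by apply: eq_bigr => i _; rewrite Aa -(qE (Ordinal kn)).
- move=> k l kl ln; case: As => sorted_s _.
  have := sorted_leq_nth (rev_trans le_trans) (fun x => lexx x) 0 sorted_s.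
  move=> /(_ k l); rewrite !inE size_tuple; apply => //.
  exact: leq_ltn_trans kl ln.
- move=> k nk; split; first by rewrite nth_default// size_tuple.
    by move=> j; rewrite /q insubF// ltnNge nk.
  by move=> j; rewrite /q; case: insub => // ?; rewrite insubF// ltnNge nk.
Qed.

(** * Square-integrable functions and orthonormal bases *)

Section square_integrable.
Context d (T : measurableType d) (R : realType).
Variable mu : {measure set T -> \bar R}.
Local Notation L2 := (Lfun mu 2%:E).
Local Notation "'[ f , g ]" := (L2_inner mu f g).
Implicit Types f g : T -> R.

Lemma L2_measurable f : f \in L2 -> measurable_fun setT f.
Proof. by rewrite inE => /andP[/[!inE]]. Qed.

Lemma L2_mul_integrable f g : f \in L2 -> g \in L2 ->
  mu.-integrable setT (EFin \o (fun t => f t * g t)).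
Proof. by move=> f2 g2; exact/Lfun1_integrable/Lfun2_mul_Lfun1. Qed.

(** The converse of [Lfun2_integrable_sqr], for use as an introduction rule. *)
Lemma L2_intro f : measurable_fun setT f ->
  mu.-integrable setT (EFin \o (fun t => f t ^+ 2)) -> f \in L2.
Proof.
move=> mf /integrableP[_ fi]; rewrite inE; apply/andP; split; rewrite inE//=.
rewrite /finite_norm unlock /Lnorm/= poweR_lty//.
apply: le_lt_trans fi; rewrite le_eqVlt; apply/orP; left; apply/eqP.
by apply: eq_integral => t _ /=; rewrite normrX powR_mulrn.
Qed.

Lemma L2_dominated f g : measurable_fun setT f -> g \in L2 ->
  (forall t, `|f t| <= g t) -> f \in L2.
Proof.
move=> mf g2 fg; apply: L2_intro => //.
apply: le_integrable (Lfun2_integrable_sqr g2) => //.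
  by apply/measurable_EFinP; exact: measurable_funX.
move=> t _ /=; rewrite lee_fin !normrX ler_pXn2r ?nnegrE//.
by rewrite (le_trans (fg t))// ler_norm.
Qed.

Lemma L2D f g : f \in L2 -> g \in L2 -> (fun t => f t + g t) \in L2.
Proof. by move=> f2 g2; case: (@Lfun_addr_closed _ _ _ mu _ (lee1n 2)) => _; apply. Qed.

Lemma L2Z c f : f \in L2 -> (fun t => c * f t) \in L2.
Proof.
by move=> f2; rewrite (_ : (fun _ => _) = c \o* f) ?Lfun_scale// ?ler1n//;
  apply/funext => t /=; rewrite mulrC.
Qed.

Lemma L2B f g : f \in L2 -> g \in L2 -> (fun t => f t - g t) \in L2.
Proof.
move=> f2 g2; rewrite (_ : (fun _ => _) = fun t => f t + -1 * g t).
  exact/L2D/L2Z.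
by apply/funext => t; rewrite mulN1r.
Qed.

Lemma L2_sum n (c : 'I_n -> R) (f : 'I_n -> T -> R) : (forall j, f j \in L2) ->
  (fun t => \sum_(j < n) c j * f j t) \in L2.
Proof.
move=> f2; elim: n c f f2 => [|n IH] c f f2.
  under eq_fun do rewrite big_ord0.
  apply: L2_intro; first exact: measurable_cst.
  under eq_fun do rewrite expr0n/=.
  exact: integrable0.
under eq_fun do rewrite big_ord_recr/=.
by apply: L2D; [exact: IH | exact: L2Z].
Qed.

Lemma innerC f g : '[f, g] = '[g, f].
Proof. by apply: eq_Rintegral => t _; rewrite mulrC. Qed.

Lemma innerDl f g u : f \in L2 -> g \in L2 -> u \in L2 ->
  '[fun t => f t + g t, u] = '[f, u] + '[g, u].
Proof.
move=> f2 g2 u2; rewrite -RintegralD//; [|exact: L2_mul_integrable..].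
by apply: eq_Rintegral => t _; rewrite mulrDl.
Qed.

Lemma innerZl c f g : f \in L2 -> g \in L2 -> '[fun t => c * f t, g] = c * '[f, g].
Proof.
move=> f2 g2; rewrite -RintegralZl//; last exact: L2_mul_integrable.
by apply: eq_Rintegral => t _; rewrite mulrA.
Qed.

Lemma innerBl f g u : f \in L2 -> g \in L2 -> u \in L2 ->
  '[fun t => f t - g t, u] = '[f, u] - '[g, u].
Proof.
move=> f2 g2 u2; rewrite -RintegralB//; [|exact: L2_mul_integrable..].
by apply: eq_Rintegral => t _; rewrite mulrBl.
Qed.

Lemma inner_suml n (c : 'I_n -> R) (f : 'I_n -> T -> R) g :
  (forall j, f j \in L2) -> g \in L2 ->
  '[fun t => \sum_(j < n) c j * f j t, g] = \sum_(j < n) c j * '[f j, g].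
Proof.
move=> f2 g2; elim: n c f f2 => [|n IH] c f f2.
  rewrite big_ord0 /L2_inner; under eq_Rintegral do rewrite big_ord0 mul0r.
  by rewrite Rintegral_cst// mul0r.
under [X in '[X, _]]eq_fun do rewrite big_ord_recr/=.
by rewrite innerDl ?innerZl ?IH ?big_ord_recr//; [exact: L2_sum|exact: L2Z].
Qed.

Lemma inner_ge0 f : 0 <= '[f, f].
Proof. by apply: Rintegral_ge0 => t _; rewrite -expr2 sqr_ge0. Qed.

Lemma EFin_inner f : f \in L2 -> ('[f, f]%:E = \int[mu]_t (f t ^+ 2)%:E)%E.
Proof.
move=> f2; rewrite /L2_inner /Rintegral.
under eq_integral do rewrite -expr2.
by rewrite fineK//; apply: integrable_fin_num => //; exact: Lfun2_integrable_sqr.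
Qed.

Lemma inner_norm f : f \in L2 -> '[f, f] = fine ('N[mu]_2%:E[EFin \o f])%E ^+ 2.
Proof.
move=> f2.
have Nfin : ('N[mu]_2%:E[EFin \o f])%E \is a fin_num.
  rewrite ge0_fin_numE ?Lnorm_ge0//.
  by move: f2; rewrite inE => /andP[_]; rewrite inE.
apply: EFin_inj; rewrite EFin_inner//.
transitivity (('N[mu]_2%:E[EFin \o f])%E `^ 2)%E.
  rewrite powR_Lnorm ?pnatr_eq0//; apply: eq_integral => t _.
  by rewrite poweR_EFin powR_mulrn// real_normK ?num_real.
rewrite -[in LHS](fineK Nfin) poweR_EFin powR_mulrn//.
by rewrite fine_ge0 ?Lnorm_ge0.
Qed.

Lemma inner_eq0 f : f \in L2 -> '[f, f] = 0 -> {ae mu, forall t, f t = 0}.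
Proof.
move=> f2 f0.
have mf2 : measurable_fun setT (fun t => (f t ^+ 2)%:E).
  by apply/measurable_EFinP; apply: measurable_funX; exact: L2_measurable.
have : (\int[mu]_t `|(f t ^+ 2)%:E| = 0)%E.
  under eq_integral => t _ do rewrite gee0_abs ?lee_fin ?sqr_ge0//.
  by rewrite -EFin_inner// f0.
move=> /(ae_eq_integral_abs mu measurableT mf2).1.
apply: filterS => t /(_ I)/= [/eqP].
by rewrite sqrf_eq0 => /eqP.
Qed.

Lemma inner_ae f f' g : f \in L2 -> f' \in L2 -> g \in L2 ->
  {ae mu, forall t, f t = f' t} -> '[f, g] = '[f', g].
Proof.
move=> f2 f'2 g2 ff'; congr fine; apply: ae_eq_integral => //.
- exact: measurable_int (L2_mul_integrable f2 g2).
- exact: measurable_int (L2_mul_integrable f'2 g2).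
- by apply: filterS ff' => t /= -> _.
Qed.

Lemma inner_cauchy_schwarz f g : f \in L2 -> g \in L2 ->
  '[f, g] ^+ 2 <= '[f, f] * '[g, g].
Proof.
move=> f2 g2; apply: discriminant_le; first exact: inner_ge0.
move=> t; have := inner_ge0 (fun x => f x - t * g x).
have tg2 := L2Z t g2.
rewrite innerBl//; last exact: L2B.
have -> : '[f, fun x => f x - t * g x] = '[f, f] - t * '[f, g].
  by rewrite innerC innerBl// innerZl// [X in _ - _ * X]innerC.
have -> : '[fun x => t * g x, fun x => f x - t * g x] =
    t * '[f, g] - t ^+ 2 * '[g, g].
  rewrite innerZl//; last exact: L2B.
  by rewrite innerC innerBl// innerZl//; ring.
by move=> h; rewrite (_ : _ + _ =
  '[f, f] - t * '[f, g] - (t * '[f, g] - t ^+ 2 * '[g, g]))//; ring.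
Qed.

Section basis.
Variable psi : nat -> T -> R.
Hypothesis hpsi : orthonormal_basis mu psi.

Definition expansion_residual f n t := f t - \sum_(j < n) '[f, psi j] * psi j t.

Lemma residual_L2 f n : f \in L2 -> expansion_residual f n \in L2.
Proof.
case: hpsi => psi2 _ _ f2; apply: L2B => //.
exact: (L2_sum (fun j : 'I_n => '[f, psi j])).
Qed.

Lemma inner_residual f g n : f \in L2 -> g \in L2 ->
  '[expansion_residual f n, g] =
  '[f, g] - \sum_(j < n) '[f, psi j] * '[g, psi j].
Proof.
case: hpsi => psi2 _ _ f2 g2; rewrite innerBl//; last exact: L2_sum.
rewrite inner_suml//; congr (_ - _).
by apply: eq_bigr => j _; rewrite [X in _ * X]innerC.
Qed.

Lemma residual_orthogonal f n k : f \in L2 -> (k < n)%N ->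
  '[expansion_residual f n, psi k] = 0.
Proof.
case: (hpsi) => psi2 psi1 _ f2 kn; rewrite inner_residual//.
rewrite (bigD1 (Ordinal kn))//= psi1 eqxx mulr1 big1 ?addr0 ?subrr// => j jk.
by rewrite psi1 (_ : (_ == _) = false) ?mulr0//; apply/negbTE; rewrite eq_sym.
Qed.

Lemma bessel f n : f \in L2 -> \sum_(j < n) '[f, psi j] ^+ 2 <= '[f, f].
Proof.
case: (hpsi) => psi2 _ _ f2; rewrite -subr_ge0.
have r2 := residual_L2 n f2.
suff -> : '[f, f] - \sum_(j < n) '[f, psi j] ^+ 2 =
    '[expansion_residual f n, expansion_residual f n] by exact: inner_ge0.
rewrite inner_residual// [X in _ = _ - X]big1 ?subr0.
  by rewrite [RHS]innerC inner_residual//; congr (_ - _); apply: eq_bigr => j _; rewrite expr2.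
by move=> j _; rewrite residual_orthogonal// mulr0.
Qed.

Lemma residual_cvg0 f : f \in L2 ->
  (fun n => '[expansion_residual f n, expansion_residual f n]) @ \oo --> (0 : R).
Proof.
case: (hpsi) => _ _ + f2 => /(_ f f2) /fine_cvg /= N0.
under eq_fun => n do rewrite (inner_norm (residual_L2 n f2)).
have -> : (0 : R) = 0 ^+ 2 by rewrite expr0n.
exact: cvg_sqr.
Qed.

(** The difference of both sides is the scalar product of g with the residual of f,
    to which the Cauchy-Schwarz inequality applies. *)
Lemma parseval f g : f \in L2 -> g \in L2 ->
  (fun n => \sum_(j < n) '[f, psi j] * '[g, psi j]) @ \oo --> '[f, g].
Proof.
move=> f2 g2.
suff : (fun n => '[expansion_residual f n, g]) @ \oo --> (0 : R).
  move=> r0; rewrite -[X in _ --> X]subr0.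
  rewrite (_ : (fun _ => _) = fun n => '[f, g] - '[expansion_residual f n, g]).
    by apply: cvgB => //; exact: cvg_cst.
  by apply/funext => n; rewrite inner_residual// opprB addrC subrK.
apply: norm_cvg0.
apply: (@squeeze_cvgr _ _ _ _ (cst 0)
  (fun n => Num.sqrt ('[expansion_residual f n, expansion_residual f n] * '[g, g]))).
- apply: nearW => n; rewrite normr_ge0/= -sqrtr_sqr ler_wsqrtr//.
  by apply: inner_cauchy_schwarz => //; exact: residual_L2.
- exact: cvg_cst.
- have -> : (0 : R) = Num.sqrt (0 * '[g, g]) by rewrite mul0r sqrtr0.
  apply: continuous_cvg; first exact: sqrt_continuous.
  by apply: cvgM; [exact: residual_cvg0 | exact: cvg_cst].
Qed.

Lemma coordinates0_ae f : f \in L2 -> (forall j, '[f, psi j] = 0) ->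
  {ae mu, forall t, f t = 0}.
Proof.
move=> f2 f0; apply: inner_eq0 => //.
have := residual_cvg0 f2.
rewrite (_ : (fun _ => _) = cst '[f, f]).
  by move=> /(cvg_unique (@Rhausdorff R) (cvg_cst _)).
apply/funext => n; congr L2_inner; apply/funext => t;
  by rewrite /expansion_residual big1 ?subr0// => j _; rewrite f0 mul0r.
Qed.

End basis.
End square_integrable.

(** * Integral operators with a kernel of rank-one bound *)

Section kernel_operator.
Context d (T : measurableType d) (R : realType).
Variable mu : {sigma_finite_measure set T -> \bar R}.
Local Notation L2 := (Lfun mu 2%:E).
Local Notation "'[ f , g ]" := (L2_inner mu f g).
Variables (K : T -> T -> R) (kap : T -> R).
Hypotheses (mK : measurable_fun setT (fun p : T * T => K p.1 p.2))
  (Ksym : forall s t, K s t = K t s)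
  (kap2 : kap \in L2) (kap_ge0 : forall t, 0 <= kap t)
  (Kkap : forall s t, `|K s t| <= kap s * kap t).
Local Notation op := (kernel_operator mu K).

Lemma kernel_section_L2 s : K s \in L2.
Proof.
apply: (L2_dominated _ (L2Z (kap s) kap2)) => //.
exact: (measurable_fun_pair2 s mK).
Qed.

Lemma kernel_section_norm s : '[K s, K s] <= kap s ^+ 2 * '[kap, kap].
Proof.
have kk : '[kap, kap] = \int[mu]_t kap t ^+ 2.
  by apply: eq_Rintegral => t _; rewrite expr2.
rewrite kk -RintegralZl//; last exact: Lfun2_integrable_sqr.
apply: le_Rintegral => //.
- exact/L2_mul_integrable/kernel_section_L2/kernel_section_L2.
- have := Lfun2_integrable_sqr (L2Z (kap s) kap2).
  by apply: eq_integrable => // t _ /=; rewrite exprMn.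
- move=> t _; rewrite -expr2 -exprMn -real_normK ?num_real//.
  by rewrite ler_pXn2r ?nnegrE ?mulr_ge0.
Qed.

Lemma kernel_operatorE f s : op f s = '[K s, f].
Proof. by []. Qed.

Lemma kernel_operator_sqr_le f s : f \in L2 ->
  op f s ^+ 2 <= kap s ^+ 2 * '[kap, kap] * '[f, f].
Proof.
move=> f2; rewrite (le_trans (inner_cauchy_schwarz (kernel_section_L2 s) f2))//.
by rewrite ler_wpM2r ?inner_ge0 ?kernel_section_norm.
Qed.

Lemma kernel_operator_bound f s : f \in L2 ->
  `|op f s| <= Num.sqrt ('[kap, kap] * '[f, f]) * kap s.
Proof.
move=> f2; rewrite -sqrtr_sqr -[X in _ * X](ger0_norm (kap_ge0 s)) -[in leRHS]sqrtr_sqr.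
rewrite -sqrtrM ?mulr_ge0 ?inner_ge0// ler_wsqrtr//.
rewrite (le_trans (kernel_operator_sqr_le s f2))//.
by rewrite -mulrA [leLHS]mulrC.
Qed.

(** The integrand is not known to be integrable for the product measure, so the
    positive and the negative part are integrated separately. *)
Lemma measurable_kernel_operator f : f \in L2 -> measurable_fun setT (op f).
Proof.
move=> f2; pose F (p : T * T) : \bar R := (K p.1 p.2 * f p.2)%:E.
have mF : measurable_fun setT F.
  apply/measurable_EFinP; apply: measurable_funM => //.
  by apply: measurableT_comp (L2_measurable f2) _; exact: measurable_snd.
rewrite (_ : op f = fun s => fine (fubini_F mu F^\+ s - fubini_F mu F^\- s)%E).
  apply: measurableT_comp; first exact: fine_measurable.
  apply: emeasurable_funB; apply: measurable_fun_fubini_tonelli_F => //.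
  - exact: measurable_funepos.
  - exact: measurable_funeneg.
apply/funext => s; rewrite /kernel_operator /Rintegral integralE.
by congr (fine (_ - _)%E); apply: eq_integral => t _; rewrite ?funeposE ?funenegE.
Qed.

Lemma kernel_operator_L2 f : f \in L2 -> op f \in L2.
Proof.
move=> f2; apply: (L2_dominated (measurable_kernel_operator f2)
  (L2Z (Num.sqrt ('[kap, kap] * '[f, f])) kap2)).
by move=> s; exact: kernel_operator_bound.
Qed.

Lemma kernel_operator_norm f : f \in L2 ->
  '[op f, op f] <= '[kap, kap] ^+ 2 * '[f, f].
Proof.
move=> f2; have kk : '[kap, kap] = \int[mu]_t kap t ^+ 2.
  by apply: eq_Rintegral => t _; rewrite expr2.
rewrite expr2 mulrAC mulrC [X in X * _]kk -RintegralZr//; last exact: Lfun2_integrable_sqr.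
apply: le_Rintegral => //.
- exact/L2_mul_integrable/kernel_operator_L2/f2/kernel_operator_L2.
- have := integrableZr measurableT ('[kap, kap] * '[f, f]) (Lfun2_integrable_sqr kap2).
  by apply: eq_integrable.
- by move=> s _; rewrite -expr2 mulrA; exact: kernel_operator_sqr_le.
Qed.

(** Fubini's theorem applies because the integrand is dominated by the product of
    the integrable functions kap f and kap g. *)
Lemma kernel_operator_sym f g : f \in L2 -> g \in L2 -> '[op f, g] = '[f, op g].
Proof.
move=> f2 g2.
have kf2 := kernel_operator_L2 f2.
have kg2 := kernel_operator_L2 g2.
have E1 u w s : u \in L2 -> (op u s * w s)%:E = (\int[mu]_t (K s t * u t * w s)%:E)%E.
  move=> u2; have Ku := L2_mul_integrable (kernel_section_L2 s) u2.
  under eq_integral do rewrite mulrC EFinM.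
  rewrite integralZl// mulrC EFinM; congr (_ * _)%E.
  by rewrite /kernel_operator /Rintegral fineK//; exact: integrable_fin_num.
apply: EFin_inj; rewrite /L2_inner /Rintegral.
rewrite !fineK; try by apply: integrable_fin_num => //; exact: L2_mul_integrable.
under eq_integral do rewrite E1//.
under [in RHS]eq_integral do rewrite mulrC E1//.
pose F (p : T * T) : \bar R := (K p.1 p.2 * f p.2 * g p.1)%:E.
have mF : measurable_fun setT F.
  apply/measurable_EFinP; apply: measurable_funM; first apply: measurable_funM => //.
    by apply: measurableT_comp (L2_measurable f2) _; exact: measurable_snd.
  by apply: measurableT_comp (L2_measurable g2) _; exact: measurable_fst.
have iF : (mu \x mu)%E.-integrable setT F.
  apply/integrable12ltyP => //.
  have kf := L2_mul_integrable kap2 f2.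
  have kg := L2_mul_integrable kap2 g2.
  have akf : mu.-integrable setT (fun t => `|kap t * f t|%:E).
    exact: (integrable_abse kf).
  have akg : mu.-integrable setT (fun t => `|kap t * g t|%:E).
    exact: (integrable_abse kg).
  pose c := (\int[mu]_t `|kap t * f t|)%R.
  have cE : (\int[mu]_t `|kap t * f t|%:E)%E = c%:E.
    by rewrite /c /Rintegral fineK//; exact: integrable_fin_num.
  apply: (@le_lt_trans _ _ (\int[mu]_s (`|kap s * g s|%:E * c%:E))%E); last first.
    rewrite integralZr//.
    rewrite -(fineK (integrable_fin_num measurableT akg)) -EFinM ltry//.
  apply: ge0_le_integral => //.
  - by move=> s _; exact: integral_ge0.
  - have maF : measurable_fun setT (abse \o F).
      by apply: (measurableT_comp _ mF); exact: abse_measurable.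
    have aF0 p : (0 <= (abse \o F) p)%E by exact: abse_ge0.
    exact: (measurable_fun_fubini_tonelli_F (m2 := mu) (abse \o F) maF aF0).
  - by apply: emeasurable_funM => //; exact: measurable_int akg.
  - move=> s _; rewrite -cE -integralZl//.
    apply: ge0_le_integral => //.
    + by apply: measurableT_comp => //; exact: (measurable_fun_pair2 s mF).
    + by apply: emeasurable_funM => //; exact: measurable_int akf.
    + move=> t _; rewrite /F/= lee_fin !normrM (ger0_norm (kap_ge0 _)) (ger0_norm (kap_ge0 _)).
      rewrite (_ : kap s * _ * _ = kap s * kap t * `|f t| * `|g s|); last by ring.
      by rewrite ler_wpM2r// ler_wpM2r.
rewrite (Fubini iF).
apply: eq_integral => t _; apply: eq_integral => s _; rewrite /F/= Ksym.
by rewrite mulrAC.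
Qed.

Section basis.
Variable psi : nat -> T -> R.
Hypothesis hpsi : orthonormal_basis mu psi.

(** This is the Hilbert-Schmidt property. For fixed s, the numbers op (psi j) s are
    the coordinates of K s, so Bessel's inequality bounds the sum of their
    squares by kap(s)^2 <kap,kap>, which is integrated over s. *)
Lemma kernel_column_norms_le n :
  \sum_(j < n) '[op (psi j), op (psi j)] <= '[kap, kap] ^+ 2.
Proof.
case: (hpsi) => psi2 _ _.
have kp2 j : op (psi j) \in L2 by exact: kernel_operator_L2.
rewrite -lee_fin -sumEFin.
under eq_bigr do rewrite EFin_inner//.
rewrite -ge0_integral_sum//; last 2 first.
- by move=> j; apply: measurable_int (Lfun2_integrable_sqr (kp2 j)).
- by move=> j t _; rewrite lee_fin sqr_ge0.
have -> : (('[kap, kap] ^+ 2)%:E = \int[mu]_s ('[kap, kap]%:E * (kap s ^+ 2)%:E))%E.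
  rewrite integralZl//; last exact: Lfun2_integrable_sqr.
  by rewrite -EFin_inner// -EFinM expr2.
apply: ge0_le_integral => //.
- by move=> t _; rewrite sume_ge0// => j _; rewrite lee_fin sqr_ge0.
- apply: emeasurable_sum => j; exact: measurable_int (Lfun2_integrable_sqr (kp2 j)).
- by apply: emeasurable_funM => //; exact: measurable_int (Lfun2_integrable_sqr kap2).
- move=> s _; rewrite sumEFin lee_fin mulrC.
  apply: le_trans (kernel_section_norm s).
  rewrite (le_trans _ (bessel hpsi n (kernel_section_L2 s)))//.
Qed.

(** From an eigenvector in coordinates to an eigenfunction, without completeness
    of L^2: the function f = sum_j u_j K psi_j converges at every point, since
    the coordinates of K s are square summable, and is dominated by a multiple
    of kap. Its coordinates are those of x u by dominated convergence, and
    Parseval's identity for K s and f gives the eigenvalue equation. *)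
Lemma riesz_fischer (u : nat -> R) (x C : R) :
  (forall n, \sum_(j < n) u j ^+ 2 <= C) ->
  (forall i, (fun n => \sum_(j < n) u j * '[op (psi j), psi i]) @ \oo --> x * u i) ->
  exists f, [/\ f \in L2, forall s, op f s = x * f s &
    forall i, '[f, psi i] = x * u i].
Proof.
case: (hpsi) => psi2 _ _ uC ux.
have kp2 j : op (psi j) \in L2 by exact: kernel_operator_L2.
have kC s n : \sum_(j < n) op (psi j) s ^+ 2 <= '[K s, K s].
  exact: (bessel hpsi n (kernel_section_L2 s)).
have /choice[f fP] : forall s, exists l : R,
    (fun n => \sum_(j < n) u j * op (psi j) s) @ \oo --> l.
  move=> s; exact: (@product_series_cvg _ u (fun j => op (psi j) s) _ _ uC (kC s)).
have S2 n : (fun s => \sum_(j < n) u j * op (psi j) s) \in L2.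
  exact: (L2_sum (fun j : 'I_n => u j) (f := fun j : 'I_n => op (psi j))).
have C0 : 0 <= C by have := uC 0%N; rewrite big_ord0.
pose G s := Num.sqrt (C * '[kap, kap]) * kap s.
have SG n s : `|\sum_(j < n) u j * op (psi j) s| <= G s.
  rewrite -sqrtr_sqr /G -[X in _ * X](ger0_norm (kap_ge0 s)) -[in leRHS]sqrtr_sqr.
  rewrite -sqrtrM ?mulr_ge0 ?inner_ge0// ler_wsqrtr//.
  rewrite (le_trans (sum_cauchy_schwarz _ _ _ _))// -mulrA.
  apply: ler_pM; rewrite ?sumr_ge0//.
  - by move=> j _; exact: sqr_ge0.
  - by move=> j _; exact: sqr_ge0.
  by rewrite (le_trans (kC s n))// mulrC kernel_section_norm.
have G2 : G \in L2 by exact: L2Z.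
have mf : measurable_fun setT f.
  apply: (@measurable_fun_cvg _ _ _ _ (fun n s => \sum_(j < n) u j * op (psi j) s)).
    by move=> n; exact: L2_measurable (S2 n).
  by move=> s _; exact: fP.
have f2 : f \in L2.
  apply: (L2_dominated mf G2) => s.
  apply: (@cvgr_to_le _ \oo _ _ _ _ _ (cvg_norm (fP s))).
  by apply: nearW => n; exact: SG.
have fpsi i : '[f, psi i] = x * u i.
  have lim1 : (fun n => '[fun s => \sum_(j < n) u j * op (psi j) s, psi i]) @ \oo -->
      '[f, psi i].
    apply: fine_cvg.
    rewrite [X in _ --> X]fineK; last first.
      by apply: integrable_fin_num => //; exact: L2_mul_integrable.
    apply: (dominated_cvg measurableT (g := fun s => (G s * `|psi i s|)%:E)) => //.
    - move=> n; exact: measurable_int (L2_mul_integrable (S2 n) (psi2 i)).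
    - move=> s _; apply: cvg_EFin; first by exact: nearW.
      by apply: cvgM; [exact: fP | exact: cvg_cst].
    - have := integrable_abse (L2_mul_integrable G2 (psi2 i)).
      apply: eq_integrable => // s _ /=; rewrite normrM (ger0_norm (_ : 0 <= G s))//.
      by rewrite mulr_ge0.
    - by move=> n s _; rewrite lee_fin normrM ler_wpM2r.
  have E : (fun n => '[fun s => \sum_(j < n) u j * op (psi j) s, psi i]) =
      fun n => \sum_(j < n) u j * '[op (psi j), psi i].
    apply/funext => n.
    by rewrite (inner_suml (fun j : 'I_n => u j) (f := fun j : 'I_n => op (psi j))).
  by rewrite E in lim1; exact: (cvg_unique (@Rhausdorff R) lim1 (ux i)).
exists f; split => // s.
have pars := parseval hpsi (kernel_section_L2 s) f2.
have E : (fun n => \sum_(j < n) '[K s, psi j] * '[f, psi j]) =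
    fun n => x * \sum_(j < n) u j * op (psi j) s.
  apply/funext => n; rewrite mulr_sumr; apply: eq_bigr => j _.
  by rewrite fpsi -kernel_operatorE mulrC mulrA.
rewrite E in pars; apply: (cvg_unique (@Rhausdorff R) pars).
by apply: cvgM; [exact: cvg_cst | exact: fP].
Qed.

(** The left hand side is made of the coordinates of the image under the operator of
    the residual of f, by symmetry and the eigenvalue equation; Bessel's
    inequality and the boundedness of the operator conclude. *)
Lemma eigenfunction_residual f x n : f \in L2 ->
  {ae mu, forall s, x * f s = op f s} ->
  \sum_(k < n) (\sum_(j < n) '[f, psi j] * '[op (psi j), psi k] -
    x * '[f, psi k]) ^+ 2 <=
  '[kap, kap] ^+ 2 * '[expansion_residual mu psi f n, expansion_residual mu psi f n].
Proof.
case: (hpsi) => psi2 _ _ f2 fx.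
have r2 := residual_L2 hpsi n f2.
have kr2 := kernel_operator_L2 r2.
rewrite (le_trans _ (kernel_operator_norm r2))// (le_trans _ (bessel hpsi n kr2))//.
apply: ler_sum => k _; rewrite -sqrrN le_eqVlt; apply/orP; left; apply/eqP.
congr (_ ^+ 2).
rewrite kernel_operator_sym// inner_residual//; last exact: kernel_operator_L2.
rewrite opprB; congr (_ - _).
  rewrite -innerZl//; rewrite -kernel_operator_sym//.
  by apply: inner_ae => //; [exact: L2Z | exact: kernel_operator_L2].
by apply: eq_bigr => j _; congr (_ * _); rewrite kernel_operator_sym// innerC.
Qed.

End basis.
End kernel_operator.

(** * Sequences with equal multiplicities *)

Lemma card_eq_proper (T : choiceType) (A B : set T) (x : T) m :
  A `<=` B -> B x -> ~ A x -> (A #= `I_m)%card -> (B #= `I_m)%card -> False.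
Proof.
move=> AB Bx nAx Am Bm.
have fA : finite_set A by apply/finite_setP; exists m.
have fB : finite_set B by apply/finite_setP; exists m.
have : (A #= B)%card by apply: card_eq_trans Am _; rewrite card_eq_sym.
move=> /(fcard_eq fA fB) cAB.
have : finmap.fproper (fset_set A) (fset_set B).
  rewrite finmap.fproperEneq; apply/andP; split; last by rewrite -fset_set_sub.
  apply/eqP => /fset_set_inj => /(_ fA fB) EAB; apply: nAx; rewrite EAB; exact: Bx.
by move=> /finmap.fproper_ltn_card; rewrite cAB ltnn.
Qed.

Lemma noninc_eq_multiplicities {R : realType} (l l' : nat -> R) :
  (forall k k', (k <= k')%N -> l k' <= l k) ->
  (forall k k', (k <= k')%N -> l' k' <= l' k) ->
  (forall k, 0 <= l k) -> (forall k, 0 <= l' k) ->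
  (forall x, 0 < x -> exists m, ([set i | l i = x] #= `I_m)%card /\
    ([set i | l' i = x] #= `I_m)%card) ->
  l =1 l'.
Proof.
move=> ld l'd l0 l'0 mult; apply: ltn_ind => i IH.
(* the sequence that is larger at i takes the value it has there once more *)
have aux (f g : nat -> R) : (forall k k', (k <= k')%N -> g k' <= g k) ->
    (forall k, 0 <= g k) -> (forall k, (k < i)%N -> f k = g k) -> g i < f i ->
    (forall x, 0 < x -> exists m, ([set i | f i = x] #= `I_m)%card /\
      ([set i | g i = x] #= `I_m)%card) -> False.
  move=> gd g0 fg gfi /(_ (f i) (le_lt_trans (g0 i) gfi))[m [fm gm]].
  apply: (@card_eq_proper _ _ _ i m _ _ _ gm fm) => //=; last first.
    by move=> gi; rewrite gi ltxx in gfi.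
  move=> k /= gk; have [ki|ik] := ltnP k i; first by rewrite fg.
  by have := gd _ _ ik; rewrite gk leNgt gfi.
apply/eqP; rewrite eq_le !leNgt; apply/andP; split; apply/negP => lt_i.
- exact: (aux l l').
- apply: (aux l' l) => //; first by move=> k /IH.
  by move=> x /mult[m [? ?]]; exists m.
Qed.

(** * Convergence of the projected eigenvalues *)

(** For a given ultrafilter U and x > 0, the eigenspace of x has a basis f indexed
    by the k with l k = x, which e enumerates. The function f t has the
    coordinates x v (e t), so that independence and spanning follow from the
    corresponding facts on the limit vectors; the multiplicities of l and lam
    then agree. *)
Lemma projected_eigenvalues_cvg d (T : measurableType d) (R : realType)
    (mu : {sigma_finite_measure set T -> \bar R}) (K : T -> T -> R)
    (kap : T -> R) (psi : nat -> T -> R) (lam : nat -> R)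
    (lamhat : forall n : nat, n.-tuple R) (i : nat) :
  measurable_fun setT (fun p : T * T => K p.1 p.2) ->
  (forall s t, K s t = K t s) ->
  kap \in Lfun mu 2%:E -> (forall t, 0 <= kap t) ->
  (forall s t, `|K s t| <= kap s * kap t) ->
  orthonormal_basis mu psi ->
  eigenvalue_sequence mu K lam ->
  (forall n, ordered_characteristic_roots (projected_matrix mu K psi n) (lamhat n)) ->
  (fun n => nth 0 (lamhat n) i) @ \oo --> lam i.
Proof.
move=> mK Ksym kap2 kap0 Kkap hpsi [lam_noninc lam_ge0 lam_mult] hlamhat.
have [psi2 _ _] := hpsi.
pose op := kernel_operator mu K.
have op2 f : f \in Lfun mu 2%:E -> op f \in Lfun mu 2%:E.
  by move=> f2; exact: (kernel_operator_L2 mK kap2 kap0 Kkap).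
have opC f g : f \in Lfun mu 2%:E -> g \in Lfun mu 2%:E ->
    L2_inner mu (op f) g = L2_inner mu f (op g).
  by move=> f2 g2; exact: (kernel_operator_sym mK Ksym kap2 kap0 Kkap).
pose a j k := L2_inner mu (op (psi j)) (psi k).
pose h j := L2_inner mu (op (psi j)) (op (psi j)).
have asym j k : a j k = a k j by rewrite /a opC// innerC.
have ah j n : \sum_(k < n) a k j ^+ 2 <= h j.
  under eq_bigr do rewrite asym.
  by apply: bessel => //; exact: op2.
have hB n : \sum_(j < n) h j <= L2_inner mu kap kap ^+ 2.
  exact: (kernel_column_norms_le mK kap2 kap0 Kkap hpsi).
have /choice[q E] : forall n, exists q, eigensystem a n (nth 0 (lamhat n)) q.
  move=> n; apply: eigensystem_of_matrix (hlamhat n) => // j k.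
  by rewrite mxE.
apply: cvg_ultra => U UU Uoo.
pose lh n k := nth 0 (lamhat n) k.
have /choice[l ll] : forall k, exists lk : R, lh ^~ k @ U --> lk.
  move=> k; apply: (@ultra_bounded_cvg _ _ UU _ (Num.sqrt (L2_inner mu kap kap ^+ 2))).
  by move=> n; exact: (lam_norm_le ah hB E n k).
have /choice[v0 v0P] : forall kj : nat * nat, exists w : R,
    (fun n => q n kj.1 kj.2) @ U --> w.
  move=> kj; apply: (@ultra_bounded_cvg _ _ UU _ 1) => n.
  exact: (eigensystem_entry (E n)).
pose v k j := v0 (k, j).
have qv k j : (fun n => q n k j) @ U --> v k j by exact: (v0P (k, j)).
have l_noninc := limit_noninc E UU Uoo ll.
have l_ge0 := limit_ge0 ah hB E UU Uoo ll.
have -> : lam i = l i; last exact: ll.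
apply: noninc_eq_multiplicities => // x x0.
have x20 : 0 < x / 2 by rewrite divr_gt0.
have xn0 : x != 0 by rewrite gt_eqF.
(* From N on, l stays below x / 2, so that only indices below N contribute to
   the eigenspace of x. *)
have [N lN] := limit_small ah hB E UU Uoo ll x20.
pose P := [pred k : 'I_N | l k == x].
pose m := #|P|.
pose e (t : 'I_m) : nat := enum_val t.
have le_e t : l (e t) = x by have := enum_valP t; rewrite inE => /eqP.
have e_inj : injective e by move=> s t /val_inj/enum_val_inj.
have sum_e (F : nat -> R) : \sum_(k < N | l k == x) F k = \sum_(t < m) F (e t).
  rewrite (eq_bigl (fun k => k \in P)); last by move=> k; rewrite inE.
  by rewrite (big_enum_val (A := P) (fun k : 'I_N => F k)).
exists m; split; last first.
  rewrite (_ : [set k | l k = x] = range e).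
    by apply: card_eq_trans (inj_card_eq _) _; [move=> ? ? _ _; exact: e_inj|
      rewrite card_eq_sym; exact: card_II].
  apply/seteqP; split => [k /= lkx|k [t _ <-]]; last exact: le_e.
  have kN : (k < N)%N.
    rewrite ltnNge; apply/negP => /lN; rewrite lkx ltNge => /negP; apply.
    by rewrite ler_pdivrMr// ler_peMr ?ler1n// ltW.
  have kP : Ordinal kN \in P by rewrite inE lkx eqxx.
  by exists (enum_rank_in kP (Ordinal kN)) => //; rewrite /e enum_rankK_in.
apply/(lam_mult x m x0).
have /choice[f fP] : forall t : 'I_m, exists f,
    [/\ f \in Lfun mu 2%:E, forall s, op f s = x * f s &
      forall j, L2_inner mu f (psi j) = x * v (e t) j].
  move=> t; apply: (riesz_fischer mK kap2 kap0 Kkap hpsi (C := 1)).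
    by move=> n; exact: (limit_vector_sqr_le E UU qv).
  by move=> j; rewrite -(le_e t); exact: (limit_eigenvector ah E UU Uoo ll qv).
have f2 t : f t \in Lfun mu 2%:E by case: (fP t).
have coords (c : 'I_m -> R) j :
    L2_inner mu (fun s => \sum_(t < m) c t * f t s) (psi j) =
    x * \sum_(t < m) c t * v (e t) j.
  rewrite inner_suml// mulr_sumr; apply: eq_bigr => t _.
  by case: (fP t) => _ _ ->; rewrite mulrCA.
exists f; split.
- move=> t; split; first exact: f2.
  by apply: aeW => s; case: (fP t) => _ fx _; rewrite -fx.
- move=> c c0.
  pose c' k := if [pick t | e t == k] is Some t then c t else 0.
  have c'e t : c' (e t) = c t.
    rewrite /c'; case: pickP => [t' /eqP/e_inj -> //|/(_ t)].
    by rewrite eqxx.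
  have free := limit_eigenvectors_free ah hB E UU Uoo ll qv xn0 (N := N) (c := c').
  move=> t; rewrite -c'e; apply: free (le_e t); last exact: ltn_ord.
  move=> j; rewrite (sum_e (fun k => c' k * v k j)).
  under eq_bigr do rewrite c'e.
  apply: (mulfI xn0); rewrite -coords mulr0.
  have s2 : (fun s => \sum_(t < m) c t * f t s) \in Lfun mu 2%:E by exact: L2_sum.
  rewrite (inner_ae s2 (L2Z 0 s2) (psi2 j)) ?innerZl ?mul0r//.
  by apply: filterS c0 => s ->; rewrite mul0r.
- move=> g [g2 gx].
  have [c cP] : exists c : nat -> R, forall j,
      L2_inner mu g (psi j) = \sum_(k < N | l k == x) c k * v k j.
    apply: (limit_eigenvectors_span asym E UU Uoo ll qv x0 lN
      (C := L2_inner mu g g)).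
      by move=> n; exact: bessel.
    pose r n := L2_inner mu kap kap ^+ 2 *
      L2_inner mu (expansion_residual mu psi g n) (expansion_residual mu psi g n).
    apply: (@squeeze_cvgr _ _ _ _ (cst 0) r); last 2 first.
    - exact: cvg_cst.
    - rewrite -(mulr0 (L2_inner mu kap kap ^+ 2)).
      by apply: cvgM; [exact: cvg_cst | exact: residual_cvg0].
    apply: nearW => n; rewrite sumr_ge0/=; last by move=> *; exact: sqr_ge0.
    exact: (eigenfunction_residual mK Ksym kap2 kap0 Kkap hpsi).
  exists (fun t => c (e t) / x).
  have s2 : (fun s => \sum_(t < m) c (e t) / x * f t s) \in Lfun mu 2%:E.
    exact: (L2_sum (fun t => c (e t) / x)).
  suff : {ae mu, forall s, g s - \sum_(t < m) c (e t) / x * f t s = 0}.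
    by apply: filterS => s /eqP; rewrite subr_eq0 => /eqP.
  apply: (coordinates0_ae hpsi (L2B g2 s2)) => j.
  rewrite innerBl// (coords (fun t => c (e t) / x)) cP (sum_e (fun k => c k * v k j)).
  rewrite mulr_sumr -sumrB big1// => t _.
  by field.
Qed.

(** The kernel is the Gram matrix of the variables Z t in the space of square
    integrable random variables. *)
Lemma covariance_kernel_sym_le {R : realType} dO (Omega : measurableType dO)
    (P : probability Omega R) (I : Type) (Z : I -> Omega -> R)
    (K : I -> I -> R) :
  centered_gaussian_process P Z ->
  (forall s t, (K s t)%:E = ('E_P[(fun w => Z s w * Z t w)%R])%E) ->
  [/\ forall s t, K s t = K t s, forall t, 0 <= K t t &
    forall s t, `|K s t| <= Num.sqrt (K s s) * Num.sqrt (K t t)].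
Proof.
move=> GZ KE.
have KI s t : (K s t)%:E = (\int[P]_w (Z s w * Z t w)%:E)%E.
  by rewrite KE unlock.
have mZ t : measurable_fun setT (Z t).
  have [] := GZ 1%N (fun=> t) (fun=> 1).
  by under eq_fun do rewrite big_ord_recl big_ord0 addr0 mul1r.
have K0 t : 0 <= K t t.
  by rewrite -lee_fin KI integral_ge0// => w _; rewrite lee_fin -expr2 sqr_ge0.
have Z2 t : Z t \in Lfun P 2%:E.
  apply: L2_intro => //; apply/integrableP; split.
    by apply/measurable_EFinP; exact: measurable_funX.
  under eq_integral => w _ do rewrite /= ger0_norm ?sqr_ge0// expr2.
  by rewrite -KI ltry.
have Kin s t : K s t = L2_inner P (Z s) (Z t).
  by rewrite /L2_inner /Rintegral -KI.
split => //.
- by move=> s t; rewrite !Kin innerC.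
- move=> s t; rewrite -sqrtrM// -sqrtr_sqr ler_wsqrtr//.
  by rewrite !Kin; exact: inner_cauchy_schwarz.
Qed.

Lemma sqrt_diagonal_L2 {R : realType} d (T : measurableType d)
    (mu : {measure set T -> \bar R}) (K : T -> T -> R) :
  measurable_fun setT (fun p : T * T => K p.1 p.2) ->
  (forall t, 0 <= K t t) -> (\int[mu]_t (K t t)%:E < +oo)%E ->
  (fun t => Num.sqrt (K t t)) \in Lfun mu 2%:E.
Proof.
move=> mK K0 trK.
have mdiag : measurable_fun setT (fun t => K t t).
  by apply: (measurableT_comp mK (measurable_fun_pair _ _)); exact: measurable_id.
apply: L2_intro.
  apply: (measurableT_comp _ mdiag); apply: continuous_measurable_fun.
  exact: sqrt_continuous.
apply/integrableP; split.
  apply/measurable_EFinP.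
  by under eq_fun do rewrite sqr_sqrtr//.
by under eq_integral => t _ do rewrite /= sqr_sqrtr// ger0_norm//.
Qed.

Theorem theorem3p1 (R : realType) (d : nat) (hd : (0 < d)%N)
    (M : set (Rspace R d)) (mM : measurable M) (M0 : M !=set0)
    (mu : {finite_measure set (trace_type M0) -> \bar R})
    (hmu : weighted_lebesgue mu \/ discrete_density mu)
    (dO : measure_display) (Omega : measurableType dO)
    (P : probability Omega R) (Z : trace_type M0 -> Omega -> R)
    (K : trace_type M0 -> trace_type M0 -> R)
    (hK : gaussian_covariance_kernel P mu Z K)
    (trK : (\int[mu]_t (K t t)%:E < +oo)%E)
    (psi : nat -> trace_type M0 -> R) (hpsi : orthonormal_basis mu psi)
    (lam : nat -> R) (hlam : eigenvalue_sequence mu K lam)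
    (lamhat : forall n : nat, n.-tuple R)
    (hlamhat : forall n : nat,
      ordered_characteristic_roots (projected_matrix mu K psi n) (lamhat n))
    (i : nat) :
  `|nth 0 (lamhat n) i - lam i| @[n --> \oo] --> (0 : R).
Proof.
case: hK => GZ _ KE mK.
have [Ksym K0 Kle] := covariance_kernel_sym_le GZ KE.
have kap2 := sqrt_diagonal_L2 mK K0 trK.
have kap0 t : 0 <= Num.sqrt (K t t) by exact: sqrtr_ge0.
have lim := projected_eigenvalues_cvg (i := i) mK Ksym kap2 kap0 Kle hpsi hlam hlamhat.
have /(_ _ _ _) := cvg_norm (cvgB lim (cvg_cst (lam i))).
by rewrite subrr normr0; apply.
Qed.
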